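(* Adding a single Cohen real forces that for each $s \in \omega$ there is a special cycle--free Hajnal--Máté graph without odd cycles of length at most $2s+1$. That is, every condition in $\mathrm{Add}(\omega,1)$ forces the statement: ''for every $s \in \omega$ there is a Hajnal--Máté graph $G$ (on $\omega_1$) such that $G$ contains no special cycles and $G$ contains no odd cycles of length at most $2s+1$.''
   Context: The background theory (of the ground model) is ZFC. $\mathrm{Add}(\omega,1)$ is the forcing to add a single Cohen real: its conditions are all functions from a natural number to $\omega$, ordered by reverse inclusion. A graph is a pair $(X,E)$ with $E \subseteq [X]^2$. Its chromatic number is the least cardinal $\mu$ such that there is $c : X \to \mu$ with $c(u) \ne c(v)$ whenever $\{u,v\} \in E$. A Hajnal--Máté graph (HM graph) is a graph $G = (\omega_1, E)$ whose chromatic number is uncountable and such that, for all $\alpha < \beta < \omega_1$, the set $\{\gamma < \alpha \mid \{\gamma,\beta\} \in E\}$ is finite. For a natural number $n \ge 3$ and an injective sequence $(x_0,\dots,x_{n-1})$ of vertices, $(x_0,\dots,x_{n-1},x_0)$ is a cycle of length $n$ if $\{x_i,x_{i+1}\} \in E$ for all $i<n-1$ and $\{x_{n-1},x_0\} \in E$. An odd cycle is a cycle of odd length. A cycle $\langle x_0,\dots,x_{n-1},x_0\rangle$ in a graph on $\omega_1$ is called special if there is $r<n$ such that $x_i > x_{i+1}$ for all $i<r$ and $x_i < x_{i+1}$ for all $r \le i < n$, where $x_n := x_0$. A graph on $\omega_1$ is special cycle--free if it contains no special cycles. *)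

(* Defs.v *)
From mathcomp Require Import all_boot.
Set Implicit Arguments.
Unset Strict Implicit.
Unset Printing Implicit Defensive.

(** The ground model is the cumulative hierarchy of Aczel-style sets over a
    universe of types: together with excluded middle and choice, it satisfies
    ZFC.  A [P]-name is a small set of pairs (name, condition). *)
Inductive name (P : Type) : Type :=
  Name (K : Type) (elt : K -> name P) (cond : K -> P).

(** Formulas of the language of set theory with parameters in [V], in
    higher-order abstract syntax.  Every formula below is parametric in [V],
    hence is an ordinary first-order formula. *)
Inductive form (V : Type) : Type :=
| Mem of V & V
| Eq of V & V
| Not of form V
| And of form V & form V
| Or of form V & form V
| Imp of form V & form V
| All of V -> form V
| Ex of V -> form V.

Declare Scope form_scope.
Delimit Scope form_scope with F.
Bind Scope form_scope with form.
Local Open Scope form_scope.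

Notation "x ∈ y" := (Mem x y) (at level 70, no associativity) : form_scope.
Notation "x ≡ y" := (Eq x y) (at level 70, no associativity) : form_scope.
Notation "¬ A" := (Not A) (at level 75, right associativity) : form_scope.
Notation "A ∧ B" := (And A B) (at level 80, right associativity) : form_scope.
Notation "A ∨ B" := (Or A B) (at level 85, right associativity) : form_scope.
Notation "A → B" := (Imp A B)
  (at level 99, B at level 200, right associativity) : form_scope.
Notation "A ↔ B" := (And (Imp A B) (Imp B A))
  (at level 95, no associativity) : form_scope.
Notation "∀ x , A" := (All (fun x => A))
  (at level 200, x name, A at level 200, right associativity) : form_scope.
Notation "∃ x , A" := (Ex (fun x => A))
  (at level 200, x name, A at level 200, right associativity) : form_scope.
Notation "∀ x ∈ a , A" := (All (fun x => Imp (Mem x a) A))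
  (at level 200, x name, a at level 69, A at level 200, right associativity)
  : form_scope.
Notation "∃ x ∈ a , A" := (Ex (fun x => And (Mem x a) A))
  (at level 200, x name, a at level 69, A at level 200, right associativity)
  : form_scope.

(** [le q p] means that [q] is stronger than [p]. *)

Definition dense_below (P : Type) (le : P -> P -> Prop) (p : P)
    (D : P -> Prop) : Prop :=
  forall q, le q p -> exists r, le r q /\ D r.

(** [p] forces [a = b] iff every [q <= p] that puts an element of one name
    into it forces (densely) that this element equals one of the other name. *)
Fixpoint forces_eq (P : Type) (le : P -> P -> Prop) (p : P) (a b : name P)
    {struct a} : Prop :=
  match a, b with
  | Name K x c, Name J y d =>
      (forall i q, le q p -> le q (c i) ->
         dense_below le q
           (fun r => exists j, le r (d j) /\ forces_eq le r (x i) (y j)))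
      /\
      (forall j q, le q p -> le q (d j) ->
         dense_below le q
           (fun r => exists i, le r (c i) /\ forces_eq le r (x i) (y j)))
  end.

Definition forces_mem (P : Type) (le : P -> P -> Prop) (p : P)
    (a b : name P) : Prop :=
  match b with
  | Name J y d =>
      dense_below le p
        (fun r => exists j, le r (d j) /\ forces_eq le r a (y j))
  end.

Fixpoint forces (P : Type) (le : P -> P -> Prop) (p : P) (A : form (name P))
    {struct A} : Prop :=
  match A with
  | Mem a b => forces_mem le p a b
  | Eq a b => forces_eq le p a b
  | Not A => forall q, le q p -> ~ forces le q A
  | And A B => forces le p A /\ forces le p B
  | Or A B => dense_below le p (fun q => forces le q A \/ forces le q B)
  | Imp A B => forall q, le q p -> forces le q A -> forces le q B
  | All A => forall a, forces le p (A a)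
  | Ex A => dense_below le p (fun q => exists a, forces le q (A a))
  end.

(** The sequence [p] stands for the function
    [i < size p |-> nth 0 p i], so that [onth p i = Some k] iff [(i, k)]
    belongs to its graph. *)

Definition cohen : Type := seq nat.

Definition cohen_le (q p : cohen) : Prop :=
  forall i k, onth p i = Some k -> onth q i = Some k.

Definition Subset V (x y : V) : form V := ∀ z ∈ x, z ∈ y.

Definition IsEmpty V (x : V) : form V := ∀ z, ¬ z ∈ x.

Definition IsSucc V (x y : V) : form V := ∀ z, (z ∈ y ↔ z ∈ x ∨ z ≡ x).

Definition IsUPair V (e x y : V) : form V := ∀ z, (z ∈ e ↔ z ≡ x ∨ z ≡ y).

(** Kuratowski pairs. *)
Definition IsPair V (z x y : V) : form V :=
  ∀ e, (e ∈ z ↔ IsUPair e x x ∨ IsUPair e x y).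

Definition App V (f x y : V) : form V := ∃ z ∈ f, IsPair z x y.

Definition IsFun V (f A B : V) : form V :=
  (∀ z ∈ f, ∃ x ∈ A, ∃ y ∈ B, IsPair z x y)
  ∧ (∀ x ∈ A, ∃ y, App f x y)
  ∧ (∀ x, ∀ y, ∀ y', (App f x y → App f x y' → y ≡ y')).

Definition InjectiveOn V (f A : V) : form V :=
  ∀ x ∈ A, ∀ x' ∈ A, ∀ y, (App f x y → App f x' y → x ≡ x').

Definition Surjective V (f A B : V) : form V := ∀ y ∈ B, ∃ x ∈ A, App f x y.

Definition Equinumerous V (A B : V) : form V :=
  ∃ f, IsFun f A B ∧ InjectiveOn f A ∧ Surjective f A B.

Definition Transitive V (x : V) : form V := ∀ y ∈ x, Subset y x.

(** By Foundation, the ordinals are the transitive sets of transitive sets. *)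
Definition IsOrd V (x : V) : form V := Transitive x ∧ ∀ y ∈ x, Transitive y.

Definition Inductive_set V (x : V) : form V :=
  (∃ z ∈ x, IsEmpty z) ∧ (∀ y ∈ x, ∃ z ∈ x, IsSucc y z).

Definition IsOmega V (w : V) : form V :=
  Inductive_set w ∧ ∀ x, (Inductive_set x → Subset w x).

Definition IsNat V (n : V) : form V := ∃ w, IsOmega w ∧ n ∈ w.

Definition Finite V (x : V) : form V := ∃ n, IsNat n ∧ Equinumerous x n.

Definition Countable V (x : V) : form V :=
  ∃ w, IsOmega w ∧ ∃ f, IsFun f x w ∧ InjectiveOn f x.

Definition IsOmega1 V (x : V) : form V :=
  IsOrd x ∧ (¬ Countable x) ∧ ∀ y ∈ x, Countable y.

Definition IsCard V (x : V) : form V :=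
  IsOrd x ∧ ∀ y ∈ x, ¬ Equinumerous x y.

Fixpoint IsNumeral V (k : nat) (n : V) : form V :=
  if k is k'.+1 then ∃ m, IsNumeral k' m ∧ IsSucc m n else IsEmpty n.

(** [d = 2k], by the recursion [f 0 = 0], [f (i + 1) = f i + 2]. *)
Definition IsDouble V (k d : V) : form V :=
  ∃ w, IsOmega w ∧ ∃ k1, IsSucc k k1 ∧ ∃ f, IsFun f k1 w
  ∧ (∃ z, IsEmpty z ∧ App f z z)
  ∧ (∀ i ∈ k, ∃ i1, IsSucc i i1 ∧
       ∃ u, ∃ u1, ∃ u2, App f i u ∧ IsSucc u u1 ∧ IsSucc u1 u2 ∧ App f i1 u2)
  ∧ App f k d.

Definition IsDoubleSucc V (k m : V) : form V :=
  ∃ d, IsDouble k d ∧ IsSucc d m.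

Definition Odd V (n : V) : form V := ∃ k, IsNat k ∧ IsDoubleSucc k n.

Definition AtMost V (n m : V) : form V := n ∈ m ∨ n ≡ m.

Definition IsGraph V (X E : V) : form V :=
  ∀ e ∈ E, ∃ u ∈ X, ∃ v ∈ X, (¬ u ≡ v) ∧ IsUPair e u v.

Definition Edge V (E u v : V) : form V := ∃ e ∈ E, IsUPair e u v.

Definition Colorable V (X E mu : V) : form V :=
  ∃ c, IsFun c X mu ∧
  ∀ u ∈ X, ∀ v ∈ X, ∀ k, (Edge E u v → App c u k → ¬ App c v k).

Definition IsChromaticNumber V (X E mu : V) : form V :=
  IsCard mu ∧ Colorable X E mu
  ∧ ∀ nu ∈ mu, (IsCard nu → ¬ Colorable X E nu).

Definition HajnalMate V (w1 E : V) : form V :=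
  IsGraph w1 E
  ∧ (∃ mu, IsChromaticNumber w1 E mu ∧ ¬ Countable mu)
  ∧ (∀ b ∈ w1, ∀ a ∈ b,
       ∃ N, (∀ g, (g ∈ N ↔ g ∈ a ∧ Edge E g b)) ∧ Finite N).

(** A cycle of length [n] is the sequence [c] of length [n + 1] with
    [c n = c 0]. *)
Definition IsCycle V (X E n c : V) : form V :=
  IsNat n
  ∧ (∃ t, IsNumeral 3 t ∧ AtMost t n)
  ∧ (∃ n1, IsSucc n n1 ∧ IsFun c n1 X)
  ∧ (∃ z, IsEmpty z ∧ ∃ u, App c z u ∧ App c n u)
  ∧ InjectiveOn c n
  ∧ (∀ i ∈ n, ∃ i1, IsSucc i i1 ∧
       ∃ u, ∃ v, App c i u ∧ App c i1 v ∧ Edge E u v).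

(** The order of the ordinals is membership, and [c n = c 0] plays [x_n]. *)
Definition IsSpecial V (n c : V) : form V :=
  ∃ r ∈ n, ∀ i ∈ n, ∃ i1, IsSucc i i1 ∧
  ∃ u, ∃ v, App c i u ∧ App c i1 v ∧ (i ∈ r → v ∈ u) ∧ ((¬ i ∈ r) → u ∈ v).

Definition SpecialCycleFree V (X E : V) : form V :=
  ¬ ∃ n, ∃ c, IsCycle X E n c ∧ IsSpecial n c.

Definition NoOddCyclesUpTo V (X E m : V) : form V :=
  ¬ ∃ n, ∃ c, IsCycle X E n c ∧ Odd n ∧ AtMost n m.

(* Main.v *)
(** Fix a partition of a set of size [omega1] into stationary pieces indexed by
    finite sequences of ordinals, so that every vertex [b] carries a tuple and a
    floor [f b < b]. An edge [g < b] is allowed only if the tuples interleave in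
    a pattern of shift type, which rules out short odd cycles, and if
    [f b < f g < g]. Then everything reachable from [g] by descending edges lies
    above [f g]. The Cohen real chooses the neighbours of [b] below [b], each
    with a floor above the preceding ones, so descending paths from [b] through
    different neighbours never meet: there are no special cycles.

    If a condition forced a countable colouring to be proper, then there would be
    a single pair of a condition [q] and a colour such that [q] forces this
    colour on a set still carrying unboundedly branching trees of tuples with
    stationary pieces at the leaves. Such trees contain interleaved tuples, and
    extending [q] by one value joins two vertices of the same colour. *)
Require Import Defs.
From mathcomp Require Import all_boot boolp wochoice zify.
Set Implicit Arguments.
Unset Strict Implicit.
Unset Printing Implicit Defensive.

(** * Stationary subsets of [omega1] *)

Record wellOrder := WellOrder {
  carrier :> Type;
  wlt : carrier -> carrier -> Prop;
  wlt_wf : well_founded wlt;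
  wlt_trans : forall y x z, wlt x y -> wlt y z -> wlt x z;
  wlt_total : forall x y, [\/ wlt x y, x = y | wlt y x] }.

Notation "x ≺ y" := (wlt x y) (at level 70, no associativity).

Definition seg (W : wellOrder) (w : W) : Type := {v : W | v ≺ w}.

Lemma wlt_irr (W : wellOrder) (x : W) : ~ x ≺ x.
Proof. by elim/(well_founded_ind (@wlt_wf W)): x => x IH xx; apply: (IH x). Qed.

Lemma wlt_min (W : wellOrder) (P : W -> Prop) (x : W) :
  P x -> exists y, P y /\ forall z, z ≺ y -> ~ P z.
Proof.
elim/(well_founded_ind (@wlt_wf W)): x => x IH Px.
have [[z [zx Pz]]|noz] := lem (exists z, z ≺ x /\ P z); first exact: IH zx Pz.
by exists x; split=> // z zx Pz; apply: noz; exists z.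
Qed.

Lemma well_order_exists (T : Type) : exists W : wellOrder, carrier W = T.
Proof.
have [R Rwo] := well_ordering_principle {classic T}.
have Rtot (x y : {classic T}) : R x y || R y x.
  by apply: (@wo_chainW _ R predT) => // A _; apply: Rwo.
have Ranti (x y : {classic T}) : R x y -> R y x -> x = y.
  move=> xy yx; apply: (@wo_chain_antisymmetric _ R predT) => //.
    by move=> A _; apply: Rwo.
  by rewrite xy yx.
have Rmin (P : T -> Prop) x : P x -> exists y, P y /\ forall z, P z -> R y z.
  move=> Px; have [|y [[Py ly] _]] := Rwo (fun x => `[<P x>]).
    by exists x; apply/asboolP.
  exists y; split; first exact/asboolP.
  by move=> z Pz; apply: ly; apply/asboolP.
pose lt (x y : T) := R x y /\ x <> y.
have lt_wf : well_founded lt.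
  move=> x; apply: contrapT => Nx.
  have [y [Ny miny]] := Rmin (fun x => ~ Acc lt x) x Nx.
  apply: Ny; constructor=> z [zy nzy]; apply: contrapT => /miny yz.
  by apply: nzy; apply: Ranti.
have lt_trans y x z : lt x y -> lt y z -> lt x z.
  move=> [xy nxy] [yz nyz]; split.
    (* Well-ordering gives every nonempty set a least element, and the least of [x], [y], [z] can
       only be [x]. *)
    have [t [t3 mint]] := Rmin (fun t => [\/ t = x, t = y | t = z]) x (Or31 _ _ erefl).
    have Rx: R t x by apply: mint; apply: Or31.
    have Ry: R t y by apply: mint; apply: Or32.
    have Rz: R t z by apply: mint; apply: Or33.
    case: t3 Rx Ry Rz {mint} => -> Rx Ry Rz //.
      by case: nxy; apply: Ranti.
    by case: nyz; apply: Ranti.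
  by move=> xz; apply: nxy; apply: Ranti => //; rewrite xz.
have lt_total x y : [\/ lt x y, x = y | lt y x].
  have [->|nxy] := lem (x = y); first by apply: Or32.
  by have /orP[xy|yx] := Rtot x y; [apply: Or31|apply: Or33; split=> // /esym].
by exists (WellOrder lt_wf lt_trans lt_total).
Qed.

(** The order type is pinned down by being uncountable with countable initial segments. The
    injections [enum_below b] are fixed as data, because the Cohen real names neighbours of [b] by
    their numbers in them. They matter only below [b]. *)
Record omega1 := Omega1 {
  omega1_order :> wellOrder;
  enum_below : omega1_order -> omega1_order -> nat;
  enum_belowI : forall b x y : omega1_order, x ≺ b -> y ≺ b ->
    enum_below b x = enum_below b y -> x = y;
  omega1_uncountable : forall f : omega1_order -> nat,
    exists x y, x <> y /\ f x = f y }.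

(** In a well-order of [nat -> bool], take the points with countably many predecessors. If they
    injected into [nat], the least point outside would have countably many predecessors too; so
    there would be none outside, against Cantor's diagonal. *)
Lemma omega1_exists : inhabited omega1.
Proof.
have [T eT] := well_order_exists (nat -> bool).
have uncT (f : T -> nat) : exists x y, x <> y /\ f x = f y.
  move: f; rewrite eT => f; apply: contrapT => inj.
  have finj x y : f x = f y -> x = y.
    by move=> fxy; apply: contrapT => nxy; apply: inj; exists x, y.
  pose d n := ~~ `[<exists2 x, f x = n & x n>].
  have dP : d (f d) = ~~ d (f d).
    rewrite {1}/d; congr negb; apply/asboolP/idP; last by exists d.
    by case=> x /finj ->.
  by case: (d (f d)) dP.
pose P (y : T) := exists f : T -> nat, forall x x', x ≺ y -> x' ≺ y -> f x = f x' -> x = x'.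
have Pdown x y : x ≺ y -> P y -> P x.
  move=> xy [f finj]; exists f => z z' zx z'x; apply: finj.
    exact: wlt_trans zx xy.
  exact: wlt_trans z'x xy.
have uncP (f : {y | P y} -> nat) : exists x y, x <> y /\ f x = f y.
  apply: contrapT => inj.
  have finj x y : f x = f y -> x = y.
    by move=> fxy; apply: contrapT => nxy; apply: inj; exists x, y.
  have /choice[g gE] : forall x, exists n, forall Px, n = f (exist P x Px).
    move=> x; have [Px|nPx] := lem (P x); last by exists 0 => Px; case: (nPx Px).
    by exists (f (exist P x Px)) => Px'; congr f; congr exist; apply: Prop_irrelevance.
  have PT x : P x.
    apply: contrapT => nPx; have [y [nPy miny]] := wlt_min (P := fun x => ~ P x) nPx.
    apply: nPy; exists g => z z' zy z'y.
    have [Pz Pz'] : P z /\ P z' by split; apply: contrapT; apply: miny.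
    by rewrite !gE => /finj; case.
  have [x [y [nxy]]] := uncT g.
  by rewrite !gE => /finj; case.
have wf : well_founded (fun x y : {y | P y} => sval x ≺ sval y).
  move=> [x Px]; elim/(well_founded_ind (@wlt_wf T)): x Px => x IH Px.
  by constructor=> -[y Py] /= /IH.
have tr (y x z : {y | P y}) : sval x ≺ sval y -> sval y ≺ sval z -> sval x ≺ sval z.
  exact: wlt_trans.
have tot (x y : {y | P y}) : [\/ sval x ≺ sval y, x = y | sval y ≺ sval x].
  case: x y => [x Px] [y Py] /=; have [xy|xy|yx] := wlt_total x y;
    [exact: Or31| |exact: Or33].
  by apply: Or32; subst y; congr exist; apply: Prop_irrelevance.
pose W := WellOrder wf tr tot.
have /choice[e eI] : forall b : W, exists e : W -> nat,
    forall x y : W, x ≺ b -> y ≺ b -> e x = e y -> x = y.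
  case=> b [f finj]; exists (fun x => f (sval x)) => -[x Px] [y Py] /= xb yb.
  move/(finj _ _ xb yb) => xy; subst y; congr exist; exact: Prop_irrelevance.
by exact: inhabits (Omega1 eI uncP).
Qed.

Section Omega1Theory.
Variable W : omega1.
Implicit Types (A B : W -> Prop) (x y b : W).

Lemma omega1_pigeonhole (C : countType) (f : W -> C) : exists x y, x <> y /\ f x = f y.
Proof.
have [x [y [nxy]]] := omega1_uncountable (fun x => pickle (f x)).
by move/(pcan_inj pickleK); exists x, y.
Qed.

(** Regularity: if [g] were unbounded, [b] could be coded by some [n] with [b] at or below [g n],
    together with its number below [g n], or [None] when it equals [g n]. *)
Lemma countable_bounded (g : nat -> W) : exists b, forall n, g n ≺ b.
Proof.
apply: contrapT => unb.
have /choice[n nP] : forall b, exists n, ~ g n ≺ b.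
  by move=> b; apply: contrapT => nb; apply: unb; exists b => n; apply: contrapT => ?;
    apply: nb; exists n.
pose f b := (n b, if `[<b = g (n b)>] then None else Some (enum_below (g (n b)) b)).
have [x [y [nxy [en]]]] := omega1_pigeonhole f.
have lt b : b <> g (n b) -> b ≺ g (n b).
  by move=> nb; have [|/nb|/nP] := wlt_total b (g (n b)).
case: asboolP => [ex|nx]; case: asboolP => [ey|ny] //.
  by case: nxy; rewrite ex ey en.
rewrite en => -[/enum_belowI exy]; apply/nxy/exy; last exact: lt.
by rewrite -en; apply: lt.
Qed.

Lemma seg_bounded (g : W -> W) (b : W) : exists b', b ≺ b' /\ forall x, x ≺ b -> g x ≺ b'.
Proof.
have /choice[h hP] : forall n, exists h, forall x, x ≺ b -> enum_below b x = n -> h = g x.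
  move=> n; have [[x [xb xn]]|no] := lem (exists x, x ≺ b /\ enum_below b x = n).
    by exists (g x) => y yb yn; congr g; apply: (enum_belowI xb yb); rewrite xn.
  by exists b => x xb xn; case: no; exists x.
have [b' b'P] := countable_bounded (fun n => if n is m.+1 then h m else b).
exists b'; split=> [|x xb]; first exact: b'P 0.
by rewrite -(hP _ x xb erefl); apply: (b'P (enum_below b x).+1).
Qed.

Lemma wlt_unbounded b : exists b', b ≺ b'.
Proof. by have [b' [? _]] := seg_bounded id b; exists b'. Qed.

Lemma wlt_max x y : exists z, x ≺ z /\ y ≺ z.
Proof.
by have [z zP] := countable_bounded (fun n => if n is 0 then x else y);
  exists z; split; [apply: zP 0|apply: zP 1].
Qed.

Lemma seq_bounded (s : seq W) x : exists b, x ≺ b /\ forall i, i < size s -> nth x s i ≺ b.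
Proof.
have [b bP] := countable_bounded (nth x (x :: s)).
by exists b; split=> [|i _]; [apply: bP 0|apply: bP i.+1].
Qed.

Definition unbounded A := forall b, exists x, b ≺ x /\ A x.

Lemma unbounded_split A (c : W -> nat) :
  unbounded A -> exists k, unbounded (fun x => A x /\ c x = k).
Proof.
move=> unA; apply: contrapT => no.
have /choice[g gP] : forall n, exists b, forall x, b ≺ x -> A x -> c x <> n.
  move=> n; apply: contrapT => nb; apply: no; exists n => b.
  apply: contrapT => nx; apply: nb; exists b => x bx Ax cx.
  by apply: nx; exists x.
have [b bP] := countable_bounded g; have [x [bx Ax]] := unA b.
by apply: (gP (c x) x) => //; apply: wlt_trans bx.
Qed.

Definition closed (g : W -> W) x := forall y, y ≺ x -> g y ≺ x.

(** The closure points of [g] form a club. Conversely every club contains all nonzero closure points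
    of the function sending [y] to the next club element above it. So this is stationarity in the
    usual sense. *)
Definition stationary A :=
  forall g b, exists x, [/\ A x, b ≺ x & closed g x].

(** If [h x] bounds both [x] and the values of [g] below [x], then the supremum of [b], [h b],
    [h (h b)], ... is closed under [g]. *)
Lemma stationaryT : stationary (fun=> True).
Proof.
move=> g b.
have /choice[h hP] : forall x, exists b, x ≺ b /\ forall y, y ≺ x -> g y ≺ b.
  by move=> x; apply: seg_bounded.
have [m mP] := countable_bounded (fun n => iter n h b).
have [x [xP minx]] := wlt_min (P := fun x => forall n, iter n h b ≺ x) mP.
exists x; split=> // [|y yx]; first exact: xP 0.
have /existsNP [n yn] := minx y yx.
have [_ hg] := hP (iter n.+1 h b); apply: wlt_trans (xP n.+2); apply: hg.
have [lt_h _] := hP (iter n h b).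
by have [y_lt| -> //|/yn[]] := wlt_total y (iter n h b); apply: wlt_trans lt_h.
Qed.

(** The nonstationary ideal is countably complete: a function dominating countably many functions
    pointwise has only closure points common to all of them. *)
Lemma stationary_split A (c : W -> nat) :
  stationary A -> exists k, stationary (fun x => A x /\ c x = k).
Proof.
move=> stA; apply: contrapT => no.
have /choice[gb gbP] : forall n, exists gb : (W -> W) * W, forall x,
    ~ [/\ A x /\ c x = n, gb.2 ≺ x & closed gb.1 x].
  move=> n; apply: contrapT => nb; apply: no; exists n => g b.
  by apply: contrapT => nx; apply: nb; exists (g, b) => x xP; apply: nx; exists x.
have [b bP] := countable_bounded (fun n => (gb n).2).
have /choice[g gP] : forall x, exists b, forall n, (gb n).1 x ≺ b.
  by move=> x; apply: countable_bounded.
have [x [Ax bx clx]] := stA g b; apply: (gbP (c x) x); split=> //.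
  exact: wlt_trans (bP _) bx.
by move=> y /clx; apply: wlt_trans.
Qed.

Lemma stationary_sub A B : (forall x, A x -> B x) -> stationary A -> stationary B.
Proof. by move=> AB stA g b; have [x [/AB]] := stA g b; exists x. Qed.

Lemma stationary_above A b : stationary A -> stationary (fun x => A x /\ b ≺ x).
Proof.
move=> stA g b'; have [m [bm b'm]] := wlt_max b b'.
have [x [Ax mx clx]] := stA g m.
by exists x; split=> //; [split=> //; apply: wlt_trans mx|apply: wlt_trans mx].
Qed.

(* Ulam's matrix: [b] belongs to the cell [(n, a)] when [a] is the [n]-th
   element of [b]; the cells of one row are disjoint, and every column has a
   stationary cell. *)
Lemma stationary_partition A : stationary A ->
  exists f : W -> W, unbounded (fun a => stationary (fun x => A x /\ f x = a)).
Proof.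
move=> stA.
have /choice[n nP] : forall a, exists n,
    stationary (fun x => (A x /\ a ≺ x) /\ enum_below x a = n).
  by move=> a; apply: stationary_split; apply: stationary_above.
have unT : unbounded (fun=> True) by move=> b; have [x] := wlt_unbounded b; exists x.
(* One row [k] holds the stationary cells of unboundedly many columns; its cells are disjoint, so
   the column can be read off as [f x]. *)
have [k unk] := unbounded_split n unT.
have /choice[f fP] : forall x, exists f, forall a, a ≺ x -> enum_below x a = k -> f = a.
  move=> x; have [[a [ax ak]]|no] := lem (exists a, a ≺ x /\ enum_below x a = k).
    by exists a => a' a'x a'k; apply: (enum_belowI ax a'x); rewrite ak.
  by exists x => a ax ak; case: no; exists a.
exists f => b; have [a [ba [_ na]]] := unk b; exists a; split=> //.
move: (nP a); apply: stationary_sub => x [[Ax ax]]; rewrite na => ek.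
by split=> //; apply: fP.
Qed.

(* [rich n i s A]: for unboundedly many [a_i], ..., for unboundedly many
   [a_(i+n-1)], stationarily many [x] in [A] have [s x j = a_j] for all
   these [j]. *)
Fixpoint rich (n i : nat) (s : W -> nat -> W) A : Prop :=
  if n is n'.+1 then unbounded (fun a => rich n' i.+1 s (fun x => A x /\ s x i = a))
  else stationary A.

Lemma rich_sub n i s s' A B :
    (forall x, A x -> B x) -> (forall x j, A x -> i <= j -> s x j = s' x j) ->
  rich n i s A -> rich n i s' B.
Proof.
elim: n i A B => [|n IH] i A B AB ss' /=; first exact: stationary_sub.
move=> unA b; have [a [ba rA]] := unA b; exists a; split=> //; move: rA; apply: IH.
  by move=> x [Ax <-]; split; [apply: AB|rewrite ss'].
by move=> x j [Ax _] ij; apply: ss' => //; apply: ltnW.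
Qed.

(** A countable colouring cannot destroy richness: each first coordinate [a] has, by induction, a
    colour that keeps its subtree rich, and one colour recurs for unboundedly many [a]. *)
Lemma rich_split n i s A (c : W -> nat) :
  rich n i s A -> exists k, rich n i s (fun x => A x /\ c x = k).
Proof.
elim: n i A => [|n IH] i A /=; first exact: stationary_split.
move=> unA.
have /choice[k kP] : forall a, exists k,
    rich n i.+1 s (fun x => A x /\ s x i = a) ->
    rich n i.+1 s (fun x => (A x /\ s x i = a) /\ c x = k).
  move=> a; have [/IH[k]|no] := lem (rich n i.+1 s (fun x => A x /\ s x i = a)).
    by exists k.
  by exists 0 => /no.
have [m unm] := unbounded_split k unA; exists m => b.
have [a [ba [/kP rA <-]]] := unm b; exists a; split=> //; move: rA.
by apply: rich_sub => // x [[]].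
Qed.

(** Ulam's partition is iterated inside its own pieces: coordinate [i] of [x] is the index [f x] of
    its piece, and later coordinates come from the tuples built for that piece. *)
Lemma rich_exists n i A : stationary A -> exists s, rich n i s A.
Proof.
elim: n i A => [|n IH] i A stA /=; first by exists (fun x _ => x).
have [f unf] := stationary_partition stA.
have /choice[s sP] : forall a, exists s,
    stationary (fun x => A x /\ f x = a) ->
    rich n i.+1 s (fun x => A x /\ f x = a).
  move=> a; have [/(IH i.+1)[s]|no] := lem (stationary (fun x => A x /\ f x = a)).
    by exists s.
  by exists (fun x _ => x) => /no.
exists (fun x j => if j == i then f x else s (f x) x j) => b.
have [a [ba /sP rA]] := unf b; exists a; split=> //; move: rA; apply: rich_sub.
  by move=> x [Ax fx]; rewrite eqxx.
by move=> x j [_ ->]; case: eqP => // ->; rewrite ltnn.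
Qed.

End Omega1Theory.

(** * The graph read off a Cohen condition *)

Lemma cohen_le_refl p : cohen_le p p.
Proof. by []. Qed.

Lemma cohen_le_trans q p r : cohen_le p q -> cohen_le q r -> cohen_le p r.
Proof. by move=> pq qr i k /qr /pq. Qed.

Arguments cohen_le_refl p : clear implicits.
Arguments cohen_le_trans [q p r] _ _ _ _ _.

Lemma cohen_le_cat p q : cohen_le (p ++ q) p.
Proof. by move=> i k pi; rewrite onth_cat -onthTE pi. Qed.

Lemma onth_lt (p : cohen) i : i < size p -> exists k, onth p i = Some k.
Proof. by rewrite -onthTE; case: onth => // k _; exists k. Qed.

Definition increasing (W : wellOrder) (n : nat) (a : nat -> W) : Prop :=
  forall i j, i < j -> j < n -> a i ≺ a j.

(** A shift relation in the style of Specker graphs: [b] enters the gap of [a] just below index [w]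
    and from there alternates with [a]. In the graph, [a] is the tuple of the larger vertex. *)
Definition shift_edge (W : wellOrder) (w n : nat) (a b : nat -> W) : Prop :=
  forall i, i + w < n -> a (i + w).-1 ≺ b i /\ b i ≺ a (i + w).

(* Potential argument: a step from [a] to [b] with [shift_edge a b] lets the
   index of a coordinate drop by [w - 1] while its value grows, a step in the
   other direction lets it rise by [w]; symmetrically for falling values. On a
   closed walk of at most [w] steps, [p] of the first kind and [q] of the
   second, [p <> q] then contradicts monotonicity of the first tuple. *)
Lemma shift_edge_odd (W : wellOrder) (w : nat) (x : nat -> nat -> W) (m : nat) :
    let n := w * w * 2 + w + 1 in
    m <= w -> odd m -> x m = x 0 -> increasing n (x 0) ->
    (forall k, k < m -> shift_edge w n (x k) (x k.+1) \/ shift_edge w n (x k.+1) (x k)) ->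
  False.
Proof.
move=> n mw om xm inc0 step.
(* Here [p] and [q] count the two kinds of steps. Index [i] follows a coordinate whose value has
   grown and [j] one whose value has fallen. Starting from the middle index [w * w], at most [w]
   moves of length at most [w] stay inside the tuple. *)
have main k : k <= m -> exists p q i j,
    [/\ p + q = k, i + p * w.-1 = w * w + q * w, j + p * w = w * w + q * w.-1,
        x 0 (w * w) ≺ x k i \/ x 0 (w * w) = x k i /\ k = 0 &
        x k j ≺ x 0 (w * w) \/ x 0 (w * w) = x k j /\ k = 0].
  elim: k => [|k IH] km.
    by exists 0, 0, (w * w), (w * w); split=> //; right.
  have [p [q [i [j [pq ei ej ui lj]]]]] := IH (ltnW km).
  have w0 : 0 < w by lia.
  have ui' y : x k i ≺ y -> x 0 (w * w) ≺ y.
    by case: ui => [u|[-> _]] //; apply: wlt_trans.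
  have lj' y : y ≺ x k j -> y ≺ x 0 (w * w).
    by case: lj => [u|[-> _]] // /wlt_trans; apply.
  have bi : w.-1 <= i /\ i + w < n by rewrite /n; nia.
  have bj : w <= j /\ j + w < n by rewrite /n; nia.
  have [sf|sb] := step k km.
    exists p.+1, q, (i - w.-1), (j - w); split; try (rewrite /n in bi bj; nia); left.
      apply: ui'; have [|+ _] := sf (i - w.-1); first lia.
      by have -> : (i - w.-1 + w).-1 = i by lia.
    apply: lj'; have [|_] := sf (j - w); first lia.
    by rewrite subnK //; lia.
  exists p, q.+1, (i + w), (j + w.-1); split; try (rewrite /n in bi bj; nia); left.
    by apply: ui'; have [|_] := sb i; first lia.
  apply: lj'; have [|+ _] := sb j; first lia.
  by have -> : (j + w).-1 = j + w.-1 by lia.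
have [p [q [i [j [pq ei ej [ui|[_ m0]] [lj|[_ m0']]]]]]] := main m (leqnn m); try lia.
move: ui lj; rewrite xm => ui lj.
(* As [p + q <= w], the case [q < p] gives [i <= w * w], against [ui]; the case [p < q] gives
   [j >= w * w], against [lj]. Oddness excludes [p = q]. *)
have [lt_qp|le_pq] := ltnP q p.
  have [eij|ij] := eqVneq i (w * w); first by rewrite eij in ui; apply: wlt_irr ui.
  apply: (@wlt_irr W (x 0 (w * w))); apply: wlt_trans ui (inc0 _ _ _ _);
    last by rewrite /n; nia.
  nia.
have [eij|ij] := eqVneq j (w * w); first by rewrite eij in lj; apply: wlt_irr lj.
have npq : p <> q by move=> epq; move: om; rewrite -pq epq addnn odd_double.
apply: (@wlt_irr W (x 0 (w * w))); apply: wlt_trans (inc0 _ _ _ _) lj;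
  last by rewrite /n; nia.
nia.
Qed.

Section HajnalMateGraph.
Variables (W : omega1) (w : nat) (s : W -> nat -> W).
Let n := w * w * 2 + w + 1.

(* The Cohen real [r] lets [b] ask, at each stage [k], for the neighbour with
   number [r k] in the enumeration of [b]; the request is granted only if the
   floor [s g n] of that neighbour [g] exceeds the elements of [b] numbered
   below [k] and all those asked for earlier. *)
Definition granted (p : cohen) (k : nat) (g b : W) : Prop :=
  onth p k = Some (enum_below b g) /\
  forall x, x ≺ b ->
    enum_below b x < k \/ (exists2 i, i < k & onth p i = Some (enum_below b x)) ->
    x ≺ s g n.

(** The sequence [s b] carries both data of a vertex: coordinates below [n] are its tuple,
    coordinate [n] is its floor. *)
Definition hm_edge (p : cohen) (g b : W) : Prop :=
  [/\ g ≺ b, increasing n (s g) /\ increasing n (s b), shift_edge w n (s b) (s g),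
      s b n ≺ s g n /\ s g n ≺ g & exists k, granted p k g b].

Definition hm_adj (p : cohen) (g b : W) : Prop := hm_edge p g b \/ hm_edge p b g.

(** Stage [k] consults the real only up to [k], where a condition longer than [k] is already
    final. *)
Lemma granted_weak q p k g b : cohen_le q p -> k < size p ->
  granted q k g b <-> granted p k g b.
Proof.
move=> qp kp.
have eqp i : i <= k -> onth q i = onth p i.
  move=> ik; have [c pc] := onth_lt (leq_ltn_trans ik kp).
  by rewrite pc; apply: qp.
have eqx x : (exists2 i, i < k & onth q i = Some x) <->
    (exists2 i, i < k & onth p i = Some x).
  by split=> -[i ik ix]; exists i; rewrite // -ix eqp // ltnW.
rewrite /granted eqp //; split=> -[-> gP]; split=> // x xb xk; apply: gP => //;
  by case: xk => [?|/eqx ?]; [left|right].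
Qed.

Lemma granted_size p k g b : granted p k g b -> k < size p.
Proof. by case=> pk _; rewrite -onthTE pk. Qed.

Lemma hm_edge_mono q p g b : cohen_le q p -> hm_edge p g b -> hm_edge q g b.
Proof.
move=> qp [gb inc sh fl [k gk]]; split=> //; exists k.
by apply/(granted_weak _ _ qp) => //; apply: granted_size gk.
Qed.

Lemma hm_adj_mono q p g b : cohen_le q p -> hm_adj p g b -> hm_adj q g b.
Proof. by move=> qp [e|e]; [left|right]; apply: hm_edge_mono e. Qed.

(** A request granted after the stage numbered by [a] has its floor above [a], hence its neighbour
    above [a]. So neighbours below [a] come from stages that [p] has already fixed; this yields
    local finiteness in the extension. *)
Lemma hm_edge_decided q p a g b : cohen_le q p ->
    a ≺ b -> enum_below b a < size p -> g ≺ a ->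
  hm_edge q g b -> hm_edge p g b.
Proof.
move=> qp ab ap ga [gb inc sh fl [k gk]]; split=> //; exists k.
apply/(granted_weak _ _ qp) => //; apply: leq_trans ap; rewrite ltnS leqNgt.
apply/negP => ak; case: gk => _ /(_ a ab (or_introl ak)) asg.
apply: (@wlt_irr _ g); apply: wlt_trans ga _; apply: wlt_trans asg _.
by case: fl.
Qed.

Lemma finite_enum (M : W -> Prop) (c : W -> nat) (l : seq nat) :
    (forall x, M x -> c x \in l) -> (forall x y, M x -> M y -> c x = c y -> x = y) ->
  exists k (h : nat -> W), (forall i j, i < k -> j < k -> h i = h j -> i = j) /\
    forall x, M x <-> exists2 i, i < k & h i = x.
Proof.
elim: l M => [|m l IH] M Ml cI.
  (* Even the empty enumeration needs some total [h], so a point of [W] is required. *)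
  have [x _] := omega1_uncountable (fun _ : W => 0).
  by exists 0, (fun=> x); split=> // y; split=> [/Ml|[]].
have [|x y [Mx _] [My _]|k [h [hI hP]]] := IH (fun x => M x /\ c x <> m).
- by move=> x [/Ml]; rewrite inE => /predU1P[].
- exact: cI.
have [[z [Mz cz]]|no] := lem (exists z, M z /\ c z = m).
  exists k.+1, (fun i => if i == k then z else h i); split.
    have hz i : i < k -> h i <> z.
      by move=> ik hi; have [_ []] : M z /\ c z <> m by apply/hP; exists i.
    have lt_k i : i < k.+1 -> i <> k -> i < k by lia.
    move=> i j ik jk; case: eqP => [->|/(lt_k _ ik) {}ik];
      case: eqP => [->|/(lt_k _ jk) {}jk] //.
    - by move=> zh; case: (hz j jk).
    - by move/(hz _ ik).
    - exact: hI.
  move=> x; split=> [Mx|[i]].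
    have [cx|cx] := eqVneq (c x) m.
      by exists k => //; rewrite eqxx; apply: cI => //; rewrite cz.
    have [|i ik hi] := (hP x).1; first by split=> //; apply/eqP.
    by exists i; [apply: ltnW|rewrite ltn_eqF].
  rewrite ltnS leq_eqVlt; case: eqP => [_ _ <- //|_ /= ik hi].
  by have [] : M x /\ c x <> m by apply/hP; exists i.
exists k, h; split=> // x; split=> [Mx|[i ik hi]].
  by apply/hP; split=> // cx; case: no; exists x.
by have [] : M x /\ c x <> m by apply/hP; exists i.
Qed.

Lemma hm_edge_finite p a b : exists k (h : nat -> W),
  (forall i j, i < k -> j < k -> h i = h j -> i = j) /\
  forall g, g ≺ a /\ hm_edge p g b <-> exists2 i, i < k & h i = g.
Proof.
apply: (@finite_enum _ (enum_below b) p) => [g [_ [_ _ _ _ [k [pk _]]]]|].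
  by rewrite -(onth_nth 0 _ _ _ pk) mem_nth // -onthTE pk.
by move=> x y [_ [xb _ _ _ _]] [_ [yb _ _ _ _]]; apply: enum_belowI.
Qed.

Lemma hm_edge_floor p g b : hm_edge p g b -> s b n ≺ s g n.
Proof. by case=> _ _ _ []. Qed.

(** Of two neighbours of [b], the one requested later has its floor above the earlier one. *)
Lemma hm_edge_disjoint p g h b : hm_edge p g b -> hm_edge p h b -> g <> h ->
  g ≺ s h n \/ h ≺ s g n.
Proof.
move=> [gb _ _ _ [k [pk gk]]] [hb _ _ _ [m [pm hm]]] ngh.
case: (ltngtP k m) => [km|mk|ekm].
- by left; apply: hm => //; right; exists k.
- by right; apply: gk => //; right; exists m.
- by case: ngh; apply: (enum_belowI gb hb); rewrite ekm pm in pk; case: pk.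
Qed.

Lemma hm_adj_lt p g b : g ≺ b -> hm_adj p g b -> hm_edge p g b.
Proof. by move=> gb [//|[bg]]; case: (@wlt_irr _ g); apply: wlt_trans bg. Qed.

Lemma hm_adjC p g b : hm_adj p g b -> hm_adj p b g.
Proof. by case; [right|left]. Qed.

(** Both [x 1] and [x k.-1] are lower neighbours of the top [x 0]. Floors grow along descending
    edges, so the bottom [x r] lies above the floors of both, and at or below both. This contradicts
    [hm_edge_disjoint]. *)
Lemma hm_special_free p k r (x : nat -> W) :
    3 <= k -> r < k -> x k = x 0 ->
    (forall i j, i < k -> j < k -> x i = x j -> i = j) ->
    (forall i, i < k -> hm_adj p (x i) (x i.+1)) ->
    (forall i, i < r -> x i.+1 ≺ x i) ->
    (forall i, r <= i -> i < k -> x i ≺ x i.+1) ->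
  False.
Proof.
move=> k3 rk xk xI adj down up.
have dn_cone i : i < r -> s (x 1) n ≺ x i.+1 /\ (x i.+1 = x 1 \/ x i.+1 ≺ x 1)
    /\ (s (x 1) n = s (x i.+1) n \/ s (x 1) n ≺ s (x i.+1) n).
  elim: i => [|i IH] ir.
    have e := hm_adj_lt (down 0 ir) (hm_adjC (adj 0 (ltn_trans ir rk))).
    by split; [case: e => _ _ _ []|split; left].
  have [_ [le1 fl1]] := IH (ltnW ir).
  have e := hm_adj_lt (down i.+1 ir) (hm_adjC (adj i.+1 (ltn_trans ir rk))).
  have fl := hm_edge_floor e.
  have fl2 : s (x 1) n ≺ s (x i.+2) n by case: fl1 => [->|f1] //; apply: wlt_trans fl.
  split; first by apply: (wlt_trans fl2); case: e => _ _ _ [].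
  split; last by right.
  right; case: le1 => [<-|]; first exact: down.
  exact: wlt_trans (down _ ir).
have ek : hm_edge p (x k.-1) (x 0).
  have k1 : k.-1 < k by lia.
  have rk1 : r <= k.-1 by lia.
  by have := hm_adj_lt (up k.-1 rk1 k1) (adj k.-1 k1); rewrite (ltn_predK k1) xk.
have up_cone i : i < k - r -> s (x k.-1) n ≺ x (k.-1 - i)
    /\ (x (k.-1 - i) = x k.-1 \/ x (k.-1 - i) ≺ x k.-1)
    /\ (s (x k.-1) n = s (x (k.-1 - i)) n \/ s (x k.-1) n ≺ s (x (k.-1 - i)) n).
  elim: i => [|i IH] ir.
    by rewrite subn0; split; [case: ek => _ _ _ []|split; left].
  have [_ [le1 fl1]] := IH (ltnW ir).
  set j := k.-1 - i.+1; have ej : k.-1 - i = j.+1 by rewrite /j; lia.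
  rewrite ej in le1 fl1.
  have [rj jk] : r <= j /\ j < k by rewrite /j; lia.
  have e := hm_adj_lt (up j rj jk) (adj j jk).
  have fl := hm_edge_floor e.
  have fl2 : s (x k.-1) n ≺ s (x j) n by case: fl1 => [->|f1] //; apply: wlt_trans fl.
  split; first by apply: (wlt_trans fl2); case: e => _ _ _ [].
  split; last by right.
  right; case: le1 => [<-|]; first exact: up.
  by apply: wlt_trans; apply: up.
(* With [r = 0] the cycle would only ascend and return to its start. *)
have r0 : 0 < r.
  case: (posnP r) => // r0; rewrite r0 in up.
  have asc i : i < k -> x 0 ≺ x i.+1.
    elim: i => [|i IH] ik; first exact: up.
    exact: wlt_trans (IH (ltnW ik)) (up _ _ ik).
  have k1 : k.-1 < k by lia.
  by have := asc k.-1 k1; rewrite (ltn_predK k1) xk => /wlt_irr.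
have e1 : hm_edge p (x 1) (x 0).
  by apply: hm_adj_lt (down 0 r0) (hm_adjC (adj 0 _)); lia.
have n1k : x 1 <> x k.-1.
  by move=> x1k; have: 1 = k.-1; [apply: xI x1k|]; lia.
have [] := dn_cone r.-1; first lia.
rewrite prednK // => flr1 [ler1 _].
have [] := up_cone (k.-1 - r); first lia.
have -> : k.-1 - (k.-1 - r) = r by lia.
move=> flrk [lerk _]; have [lt1|ltk] := hm_edge_disjoint e1 ek n1k.
  apply: (@wlt_irr _ (x 1)); apply: wlt_trans lt1 _.
  by case: ler1 flrk => [->//|r1 /wlt_trans]; apply.
apply: (@wlt_irr _ (x k.-1)); apply: wlt_trans ltk _.
by case: lerk flr1 => [->//|r1 /wlt_trans]; apply.
Qed.

Lemma hm_odd_free p k (x : nat -> W) :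
    k <= w -> odd k -> x k = x 0 ->
    (forall i, i < k -> hm_adj p (x i) (x i.+1)) ->
  False.
Proof.
move=> kw ok xk adj; apply: (@shift_edge_odd W w (fun i => s (x i)) k) => //.
- by rewrite xk.
- have k0 : 0 < k by case: (k) ok.
  by case: (adj 0 k0) => -[_ [? ?]].
- by move=> i ik; case: (adj i ik) => -[_ _ sh _ _]; [right|left].
Qed.

(** In the application [c x] consists of a condition and the code of the colour it forces on [x].
    One value of [c] stays rich, and two interleaved branches of its tree supply the tuples of [b]
    and [g]. *)
Lemma hm_chromatic (c : W -> cohen * nat) : 0 < w -> rich n.+1 0 s (fun=> True) ->
  exists g b q, [/\ c g = c b, cohen_le q (c g).1 & hm_edge q g b].
Proof.
move=> w0 rich_s.
have {rich_s} [m richA] := rich_split (fun x => pickle (c x)) rich_s.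
set A : W -> Prop := fun x => _ in richA.
pose B (u : seq W) x := A x /\ forall i, i < size u -> s x i = nth x u i.
(* [u] is a node above which the tree is still rich. There are [n.+1] levels, the last one being the
   floor. *)
pose G u := rich (n.+1 - size u) (size u) s (B u).
have G0 : G [::] by apply: rich_sub richA => // x Ax; split.
have Gext u b : size u <= n -> G u -> exists a, b ≺ a /\ G (rcons u a).
  move=> su; rewrite /G subSn // => Gu.
  have [a [ba ra]] := Gu b; exists a; split=> //; rewrite size_rcons subSS.
  move: ra; apply: rich_sub => //.
  move=> x [[Ax eu] ea]; split=> // i; rewrite size_rcons ltnS nth_rcons leq_eqVlt.
  by case/predU1P => [->|iu]; [rewrite ltnn eqxx|rewrite iu; apply: eu].
have [z0 _] := omega1_uncountable (fun _ : W => 0).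
pose inc (u : seq W) := increasing (size u) (nth z0 u).
have inc_rcons u a : inc u -> (forall i, i < size u -> nth z0 u i ≺ a) -> inc (rcons u a).
  move=> iu ua i j ij; rewrite size_rcons ltnS leq_eqVlt !nth_rcons.
  case/predU1P => [ej|ju]; first by rewrite ej in ij *; rewrite ij ltnn eqxx; apply: ua.
  by rewrite ju (ltn_trans ij ju); apply: iu.
have grow u l : size u + l <= n -> inc u -> G u ->
    exists v, [/\ size v = size u + l, inc v, G v & forall i, i < size u ->
      nth z0 v i = nth z0 u i].
  elim: l => [|l IH] ul iu Gu; first by exists u; split=> //; rewrite addn0.
  have [|v [sv iv Gv vu]] := IH _ iu Gu; first lia.
  have [b [_ bP]] := seq_bounded v z0.
  have [|a [ba Ga]] := Gext v b _ Gv; first lia.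
  have va i : i < size v -> nth z0 v i ≺ a by move=> iv'; apply: wlt_trans (bP i iv') ba.
  exists (rcons v a); split=> //.
  - by rewrite size_rcons sv addnS.
  - exact: inc_rcons.
  - by move=> i iu'; rewrite nth_rcons sv ltn_addr // vu.
(* The branch [u] starts [w] coordinates ahead. Then each round adds a coordinate to [v] above
   everything so far and one to [u] above that, which puts entry [l] of [v] into the required gap of
   [u]. *)
have weave l : w + l <= n -> exists u v, [/\ size u = w + l, size v = l, inc u /\ inc v,
  G u /\ G v &
    (forall i, i < l -> nth z0 u (i + w).-1 ≺ nth z0 v i /\ nth z0 v i ≺ nth z0 u (i + w))].
  elim: l => [|l IH] wl.
    have [||u [su iu Gu _]] := grow [::] w _ _ G0; [by rewrite addn0 in wl|by []|].
    by exists u, [::]; split=> //; rewrite su addn0.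
  have [|u [v [su sv [iu iv] [Gu Gv] uv]]] := IH; first lia.
  have [b [z0b bP]] := seq_bounded (u ++ v) z0.
  have bu i : i < size u -> nth z0 u i ≺ b.
    by move=> iu'; have := bP i; rewrite size_cat nth_cat iu' ltn_addr //; apply.
  have bv i : i < size v -> nth z0 v i ≺ b.
    by move=> iv'; have := bP (size u + i);
      rewrite size_cat nth_cat ltn_add2l ifN ?addKn; [apply|lia].
  have [|d [bd Gd]] := Gext v b _ Gv; first lia.
  have [|a [da Ga]] := Gext u d _ Gu; first lia.
  exists (rcons u a), (rcons v d); rewrite !size_rcons su sv addnS; split=> //.
    split; apply: inc_rcons => // i.
      by move=> /bu /wlt_trans; apply; apply: wlt_trans da.
    by move=> /bv /wlt_trans; apply.
  move=> i; rewrite ltnS leq_eqVlt !nth_rcons su sv => /predU1P[->|il].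
    rewrite ltnn eqxx.
    have -> : l + w < w + l = false by lia.
    have -> : l + w == w + l by lia.
    have -> : (l + w).-1 < w + l by lia.
    by split=> //; apply: wlt_trans (bu _ _) bd; rewrite su; lia.
  rewrite il.
  have -> : i + w < w + l by lia.
  have -> : (i + w).-1 < w + l by lia.
  exact: uv.
(* The number of rounds is [n - w]. This completes [u]; the last [w] coordinates of [v] are not
   constrained by [shift_edge] and are added freely. *)
have [|u [v0 [su sv0 [iu iv0] [Gu Gv0] uv0]]] := weave (w * w * 2 + 1);
  first by rewrite /n; lia.
have [|v [sv iv Gv vv0]] := grow v0 w _ iv0 Gv0; first by rewrite sv0 /n; lia.
have {}su : size u = n by rewrite su /n; lia.
have {}sv : size v = n by rewrite sv sv0 /n; lia.
move: Gu Gv; rewrite /G su sv subSnn /= => Gu Gv.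
have [f [_ stb]] := Gu z0.
(* [next a] is a vertex over [v] whose floor exceeds [a]. The vertex [b] over [u], with floor [f],
   is then chosen closed under [next], so that suitable neighbours exist below it. *)
have /choice[next nextP] : forall a, exists g, [/\ B v g, a ≺ s g n & s g n ≺ g].
  move=> a; have [f' [af' stg]] := Gv a.
  by have [g [[Bg eg] f'g _]] := stg id f'; exists g; split; rewrite ?eg.
have [b [[Bb eb] fb clb]] := stb next f.
(* The floor of the neighbour must exceed the floor [f] of [b] and the finitely many elements of [b]
   relevant at stage [size (c b).1]: those with smaller numbers and those already requested. Their
   maximum is [a]. *)
have [a [ab fa aP]] : exists a, [/\ a ≺ b, f = a \/ f ≺ a & forall x, x ≺ b ->
    enum_below b x \in iota 0 (size (c b).1) ++ (c b).1 -> x = a \/ x ≺ a].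
  elim: (iota _ _ ++ _) => [|m' l [a [ab fa aP]]]; first by exists f; split=> //; left.
  have [[x [xb xm]]|no] := lem (exists x, x ≺ b /\ enum_below b x = m').
    have xU y : y ≺ b -> enum_below b y = m' -> y = x.
      by move=> yb ym; apply: (enum_belowI yb xb); rewrite xm.
    have [xa|xa|ax] := wlt_total x a.
    - exists a; split=> // y yb; rewrite inE => /predU1P[/xU -> //|/aP]; last exact.
      by right.
    - exists a; split=> // y yb; rewrite inE => /predU1P[/xU -> //|/aP]; last exact.
      by left.
    - exists x; split=> //; first by right; case: fa => [->|/wlt_trans] //; apply.
      move=> y yb; rewrite inE => /predU1P[/xU -> //|/aP]; first by left.
      by case=> // [->|/wlt_trans ya]; right=> //; apply: ya.
  exists a; split=> // y yb; rewrite inE => /predU1P[ym|/aP]; last exact.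
  by case: no; exists y.
have [[Ag gv] ag sg] := nextP a; have gb := clb a ab.
set g := next a in Ag gv ag sg gb.
have [[_ cb] bu] := Bb; have [_ cg] := Ag.
rewrite su in bu; rewrite sv in gv.
(* The definition of [B] uses the vertex itself as default of [nth], the tuples use [z0]; below the
   common length [n] the two agree. *)
have {}bu i : i < n -> s b i = nth z0 u i.
  by move=> ni; rewrite bu //; apply: set_nth_default; rewrite su.
have {}gv i : i < n -> s g i = nth z0 v i.
  by move=> ni; rewrite gv //; apply: set_nth_default; rewrite sv.
have ecgb : c g = c b by apply: (pcan_inj pickleK); rewrite cg cb.
exists g, b, (rcons (c b).1 (enum_below b g)); split=> //.
  by rewrite ecgb -cats1; apply: cohen_le_cat.
split=> //.
- split=> i j ij jn.
    by rewrite !gv // ?(ltn_trans ij jn) //; apply: iv => //; rewrite sv.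
  by rewrite !bu // ?(ltn_trans ij jn) //; apply: iu => //; rewrite su.
- move=> i iwn; rewrite !bu ?gv; try lia.
  rewrite vv0; last by rewrite sv0; rewrite /n in iwn; lia.
  by apply: uv0; rewrite /n in iwn; lia.
- by rewrite eb; split=> //; case: fa => [->|/wlt_trans] //; apply.
- exists (size (c b).1); split.
    by rewrite -cats1 onth_cat ltnn subnn.
  move=> x xb xk; have [|->|/wlt_trans] // := aP x xb; last by apply.
  rewrite mem_cat mem_iota /= add0n; case: xk => [->//|[i ic]].
  rewrite -cats1 onth_cat ic => ei; apply/orP; right.
  by rewrite -(onth_nth 0 _ _ _ ei) mem_nth.
Qed.

End HajnalMateGraph.

(** * The forcing relation *)

Notation cname := (name cohen).
Notation "p ⊩ A" := (forces cohen_le p A%F) (at level 98, A at level 97, no associativity).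
Notation dense := (dense_below cohen_le).
Notation "q ≼ p" := (cohen_le q p) (at level 70, no associativity).

Lemma dense_mono q p (D : cohen -> Prop) : q ≼ p -> dense p D -> dense q D.
Proof. by move=> qp dD r rq; apply: dD; apply: cohen_le_trans qp. Qed.

Lemma dense_dense p (D : cohen -> Prop) : dense p (fun q => dense q D) -> dense p D.
Proof.
move=> dD q /dD[r [rq dr]]; have [t [tr Dt]] := dr r (cohen_le_refl r).
by exists t; split=> //; apply: cohen_le_trans rq.
Qed.

Lemma dense_all p (D : cohen -> Prop) : (forall q, q ≼ p -> D q) -> dense p D.
Proof. by move=> Dp q qp; exists q; split; [|apply: Dp]. Qed.

Lemma dense_sub p (D D' : cohen -> Prop) :
  dense p D -> (forall q, q ≼ p -> D q -> D' q) -> dense p D'.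
Proof.
move=> dD DD' q qp; have [r [rq Dr]] := dD q qp.
by exists r; split=> //; apply: DD' => //; apply: cohen_le_trans qp.
Qed.

Lemma dense_ex p (D : cohen -> Prop) : dense p D -> exists q, q ≼ p /\ D q.
Proof. by apply. Qed.

Lemma forces_mono A q p : q ≼ p -> p ⊩ A -> q ⊩ A.
Proof.
move=> qp; elim: A => [a b|a b|A IH|A IHA B IHB|A IHA B IHB|A IHA B IHB|A IH|A IH] /=.
- by case: b => J y d; apply: dense_mono.
- case: a b => K x c [J y d] /= [H1 H2].
  by split=> i r rq; [apply: H1|apply: H2]; apply: cohen_le_trans qp.
- by move=> H r rq; apply: H; apply: cohen_le_trans qp.
- by case=> /IHA ? /IHB.
- by apply: dense_mono.
- by move=> H r rq; apply: H; apply: cohen_le_trans qp.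
- by move=> H a; apply: IH.
- by apply: dense_mono.
Qed.

(** This lets a proof of a forced formula pass to stronger conditions; the elimination rules for
    [Ex] and [Or] rest on it. *)
Lemma forces_stable A p : dense p (fun q => q ⊩ A) -> p ⊩ A.
Proof.
elim: A p => [a b|a b|A IH|A IHA B IHB|A IHA B IHB|A IHA B IHB|A IH|A IH] p /=.
- by case: b => J y d; apply: dense_dense.
- case: a b => K x c [J y d] /= H; split=> i q qp qi r rq.
    have [t [tr [H1 _]]] := H r (cohen_le_trans rq qp).
    have [|u [ut Hu]] := H1 i t (cohen_le_refl t) _ t (cohen_le_refl t).
      by apply: cohen_le_trans qi; apply: cohen_le_trans rq.
    by exists u; split=> //; apply: cohen_le_trans tr.
  have [t [tr [_ H1]]] := H r (cohen_le_trans rq qp).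
  have [|u [ut Hu]] := H1 i t (cohen_le_refl t) _ t (cohen_le_refl t).
    by apply: cohen_le_trans qi; apply: cohen_le_trans rq.
  by exists u; split=> //; apply: cohen_le_trans tr.
- move=> H q qp qA; have [r [rq H']] := H q qp.
  by apply: (H' r (cohen_le_refl r)); apply: forces_mono qA.
- by move=> H; split; [apply: IHA|apply: IHB]; apply: dense_sub H _ => q _ [].
- by apply: dense_dense.
- move=> H q qp qA; apply: IHB => r rq; have [t [tr H']] := H r (cohen_le_trans rq qp).
  exists t; split=> //; apply: H' => //; apply: forces_mono qA.
  exact: cohen_le_trans rq.
- by move=> H a; apply: IH; apply: dense_sub H _ => q _; apply.
- by apply: dense_dense.
Qed.

Lemma forces_ex_elim A B p :
  (p ⊩ Ex A) -> (forall q x, q ≼ p -> (q ⊩ A x) -> q ⊩ B) -> p ⊩ B.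
Proof.
move=> pA AB; apply: forces_stable; apply: dense_sub pA _ => q qp [x qx].
exact: AB qx.
Qed.

Lemma forces_or_elim A A' B p : (p ⊩ A ∨ A') ->
  (forall q, q ≼ p -> (q ⊩ A) -> q ⊩ B) -> (forall q, q ≼ p -> (q ⊩ A') -> q ⊩ B) ->
  p ⊩ B.
Proof.
move=> pA AB AB'; apply: forces_stable; apply: dense_sub pA _ => q qp [qA|qA].
  exact: AB qA.
exact: AB' qA.
Qed.

Lemma forces_ex x A p : (p ⊩ A x) -> p ⊩ Ex A.
Proof. by move=> pA; apply: dense_all => q qp; exists x; apply: forces_mono pA. Qed.

Lemma forces_orl A B p : (p ⊩ A) -> p ⊩ A ∨ B.
Proof. by move=> pA; apply: dense_all => q qp; left; apply: forces_mono pA. Qed.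

Lemma forces_orr A B p : (p ⊩ B) -> p ⊩ A ∨ B.
Proof. by move=> pA; apply: dense_all => q qp; right; apply: forces_mono pA. Qed.

Lemma forces_mp A B p : (p ⊩ (A → B)) -> (p ⊩ A) -> p ⊩ B.
Proof. by move=> H; apply: H. Qed.

Lemma forces_and A B p : (p ⊩ A ∧ B) <-> (p ⊩ A) /\ (p ⊩ B).
Proof. by []. Qed.

Lemma forces_notI A p : (forall q, q ≼ p -> ~ (q ⊩ A)) -> p ⊩ ¬ A.
Proof. exact. Qed.

Lemma forces_exD A p : (p ⊩ Ex A) -> exists q, q ≼ p /\ exists x, q ⊩ A x.
Proof. exact: dense_ex. Qed.

Lemma forces_ball A p a x : (p ⊩ (∀ x ∈ a, A x)) -> (p ⊩ x ∈ a) -> p ⊩ A x.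
Proof. by move=> H; apply: H. Qed.

Lemma forces_bex_intro x A a p : (p ⊩ x ∈ a) -> (p ⊩ A x) -> p ⊩ (∃ x ∈ a, A x).
Proof. by move=> xa Ax; apply: (forces_ex (x := x)). Qed.

Lemma forces_refl a p : p ⊩ a ≡ a.
Proof.
elim: a p => K x IH c p /=; split=> i q qp qi; apply: dense_all => r rq;
  by exists i; split; [apply: cohen_le_trans qi|apply: IH].
Qed.

Lemma forces_sym a b p : (p ⊩ a ≡ b) -> p ⊩ b ≡ a.
Proof.
elim: a b p => K x IH c [J y d] p /= [H1 H2]; split=> i q qp qi.
  by apply: dense_sub (H2 i q qp qi) _ => r _ [j [rj /IH]]; exists j.
by apply: dense_sub (H1 i q qp qi) _ => r _ [j [rj /IH]]; exists j.
Qed.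

Lemma forces_trans b a c p : (p ⊩ a ≡ b) -> (p ⊩ b ≡ c) -> p ⊩ a ≡ c.
Proof.
elim: a b c p => K x IH cx [J y d] [L z e] p /= [H1 H2] [H3 H4].
split=> i q qp qi; apply: dense_dense.
  apply: dense_sub (H1 i q qp qi) _ => r rq [j [rj xy]].
  apply: dense_sub (H3 j r (cohen_le_trans rq qp) rj) _ => t tr [l [tl yz]].
  by exists l; split=> //; apply: IH yz; apply: (forces_mono (A := Eq _ _)) xy.
apply: dense_sub (H4 i q qp qi) _ => r rq [j [rj yz]].
apply: dense_sub (H2 j r (cohen_le_trans rq qp) rj) _ => t tr [l [tl xy]].
by exists l; split=> //; apply: (IH _ _ _ _ xy); apply: (forces_mono (A := Eq _ _)) yz.
Qed.

Lemma forces_meml a' a b p : (p ⊩ a ≡ a') -> (p ⊩ a ∈ b) -> p ⊩ a' ∈ b.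
Proof.
case: b => J y d /= aa' H; apply: dense_sub H _ => q qp [j [qj ay]].
exists j; split=> //; apply: (forces_trans (b := a)) ay.
by apply: forces_sym; apply: (forces_mono (A := Eq _ _)) aa'.
Qed.

Lemma forces_memr b' a b p : (p ⊩ b ≡ b') -> (p ⊩ a ∈ b) -> p ⊩ a ∈ b'.
Proof.
case: b b' => J y d [L z e] [H1 _] H; apply: dense_dense;
  apply: dense_sub H _ => q qp [j [qj ay]].
apply: dense_sub (H1 j q qp qj) _ => r rq [l [rl yz]]; exists l; split=> //.
by apply: (forces_trans (b := y j)) yz; apply: (forces_mono (A := Eq _ _)) ay.
Qed.

Lemma forces_ext a b p : (forall q z, q ≼ p -> (q ⊩ z ∈ a) -> q ⊩ z ∈ b) ->
  (forall q z, q ≼ p -> (q ⊩ z ∈ b) -> q ⊩ z ∈ a) -> p ⊩ a ≡ b.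
Proof.
case: a b => K x c [J y d] H1 H2 /=; split=> i q qp qi.
  have xa : q ⊩ x i ∈ Name x c.
    by apply: dense_all => r rq; exists i; split;
      [apply: cohen_le_trans qi|apply: forces_refl].
  exact: H1 xa.
have xa : q ⊩ y i ∈ Name y d.
  by apply: dense_all => r rq; exists i; split;
    [apply: cohen_le_trans qi|apply: forces_refl].
by apply: dense_sub (H2 _ _ qp xa) _ => r rq [j [rj /forces_sym]]; exists j.
Qed.

(** In higher-order syntax the body of a quantifier is an arbitrary function of names, which need
    not respect forced equality. Substitution is therefore proved connective by connective, and
    [forces_iff_tac] assembles it for each concrete formula. *)
Definition forces_iff p (A B : form cname) : Prop := forall q, q ≼ p -> (q ⊩ A) <-> (q ⊩ B).

Section ForcesIff.
Variable p : cohen.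

Lemma forces_iff_refl A : forces_iff p A A.
Proof. by []. Qed.

Lemma forces_iff_mem a b a' b' : (p ⊩ a ≡ a') -> (p ⊩ b ≡ b') ->
  forces_iff p (a ∈ b) (a' ∈ b').
Proof.
move=> aa bb q qp; have {}aa := forces_mono qp aa; have {}bb := forces_mono qp bb.
split=> H; first exact: forces_meml aa (forces_memr bb H).
exact: forces_meml (forces_sym aa) (forces_memr (forces_sym bb) H).
Qed.

Lemma forces_iff_eq a b a' b' : (p ⊩ a ≡ a') -> (p ⊩ b ≡ b') ->
  forces_iff p (a ≡ b) (a' ≡ b').
Proof.
move=> aa bb q qp; have {}aa := forces_mono qp aa; have {}bb := forces_mono qp bb.
split=> H; first exact: forces_trans (forces_sym aa) (forces_trans H bb).
exact: forces_trans aa (forces_trans H (forces_sym bb)).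
Qed.

Lemma forces_iff_not A A' : forces_iff p A A' -> forces_iff p (¬ A) (¬ A').
Proof.
move=> AA q qp; split=> H r rq /AA Ar; apply: (H r rq); apply: Ar;
  exact: cohen_le_trans qp.
Qed.

Lemma forces_iff_and A A' B B' : forces_iff p A A' -> forces_iff p B B' ->
  forces_iff p (A ∧ B) (A' ∧ B').
Proof.
by move=> AA BB q qp; split=> -[/(AA _ qp) ? /(BB _ qp) ?]; split.
Qed.

Lemma forces_iff_or A A' B B' : forces_iff p A A' -> forces_iff p B B' ->
  forces_iff p (A ∨ B) (A' ∨ B').
Proof.
move=> AA BB q qp; split=> H; apply: dense_sub H _ => r rq;
  by have rp := cohen_le_trans rq qp; case=> [/(AA _ rp)|/(BB _ rp)]; [left|right].
Qed.

Lemma forces_iff_imp A A' B B' : forces_iff p A A' -> forces_iff p B B' ->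
  forces_iff p (A → B) (A' → B').
Proof.
by move=> AA BB q qp; split=> H r rq; have rp := cohen_le_trans rq qp;
  move=> /(AA _ rp) /(H _ rq) /(BB _ rp).
Qed.

Lemma forces_iff_all A A' : (forall x, forces_iff p (A x) (A' x)) ->
  forces_iff p (All A) (All A').
Proof. by move=> AA q qp; split=> H x; apply/(AA x _ qp); apply: H. Qed.

Lemma forces_iff_ex A A' : (forall x, forces_iff p (A x) (A' x)) ->
  forces_iff p (Ex A) (Ex A').
Proof.
move=> AA q qp; split=> H; apply: dense_sub H _ => r rq [x xA]; exists x;
  by apply/(AA x _ (cohen_le_trans rq qp)).
Qed.

End ForcesIff.

Ltac forces_iff_tac :=
  repeat first
    [ assumption
    | exact: forces_refl
    | apply: forces_iff_refl
    | apply: forces_iff_mem | apply: forces_iff_eq | apply: forces_iff_not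
    | apply: forces_iff_and | apply: forces_iff_or | apply: forces_iff_imp
    | apply: forces_iff_all => ? | apply: forces_iff_ex => ? ].

Lemma upair_iff p e e' x x' y y' : (p ⊩ e ≡ e') -> (p ⊩ x ≡ x') -> (p ⊩ y ≡ y') ->
  forces_iff p (IsUPair e x y) (IsUPair e' x' y').
Proof. by move=> ee xx yy; rewrite /IsUPair; forces_iff_tac. Qed.

Lemma pair_iff p e e' x x' y y' : (p ⊩ e ≡ e') -> (p ⊩ x ≡ x') -> (p ⊩ y ≡ y') ->
  forces_iff p (IsPair e x y) (IsPair e' x' y').
Proof. by move=> ee xx yy; rewrite /IsPair /IsUPair; forces_iff_tac. Qed.

Lemma app_iff p f f' x x' y y' : (p ⊩ f ≡ f') -> (p ⊩ x ≡ x') -> (p ⊩ y ≡ y') ->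
  forces_iff p (App f x y) (App f' x' y').
Proof. by move=> ee xx yy; rewrite /App /IsPair /IsUPair; forces_iff_tac. Qed.

(** * Names for pairs and ordinals *)

Lemma mem_stable p (a b : cname) :
  dense p (fun q => q ⊩ a ∈ b) -> forces_mem cohen_le p a b.
Proof. exact: (@forces_stable (a ∈ b)). Qed.

Lemma cohen_le_nil p : p ≼ [::].
Proof. by move=> i k; rewrite onth0n. Qed.

Definition mkset (T : Type) (x : T -> cname) : cname := Name x (fun=> [::]).

Lemma mem_mkset T (x : T -> cname) a p :
  (p ⊩ a ∈ mkset x) <-> dense p (fun q => exists t, q ⊩ a ≡ x t).
Proof.
split=> H; apply: dense_sub H _ => q _ [t]; first by case; exists t.
by exists t; split=> //; apply: cohen_le_nil.
Qed.

Lemma mem_mkset_in T (x : T -> cname) t p : p ⊩ x t ∈ mkset x.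
Proof. by apply/mem_mkset/dense_all => q qp; exists t; apply: forces_refl. Qed.

Arguments mem_mkset_in [T] x t p _ _.

(** An arbitrary element [z] is equal to a listed name only densely often; the hypothesis on [A]
    transfers the formula along these equalities. *)
Lemma forces_ball_mkset T (x : T -> cname) (A : cname -> form cname) p :
    (forall q a b, (q ⊩ a ≡ b) -> forces_iff q (A a) (A b)) ->
  (forall t, p ⊩ A (x t)) -> p ⊩ (∀ z ∈ mkset x, A z).
Proof.
move=> Aext Ax z q qp /mem_mkset zx; apply: forces_stable.
apply: dense_sub zx _ => r rq [t zt].
apply/(Aext _ _ _ zt r (cohen_le_refl r)); apply: forces_mono (Ax t).
exact: cohen_le_trans qp.
Qed.

(** No condition identifies two names of the family. This makes the name of a graph indexed by the
    family single-valued. *)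
Definition discrete T (x : T -> cname) : Prop :=
  forall p t t', (p ⊩ x t ≡ x t') -> t = t'.

Definition upair (u v : cname) : cname := mkset (fun b : bool => if b then u else v).

Lemma mem_upair p z u v : (p ⊩ z ∈ upair u v) <-> (p ⊩ (z ≡ u ∨ z ≡ v)).
Proof.
split=> [/mem_mkset H|H].
  by apply: dense_sub H _ => q qp [[]]; [left|right].
apply/mem_mkset; apply: dense_sub H _ => q qp [H|H]; [by exists true|by exists false].
Qed.

Lemma upairP p e u v : (p ⊩ IsUPair e u v) <-> (p ⊩ e ≡ upair u v).
Proof.
split=> [H|H].
  apply: forces_ext => q z qp.
    by move=> ze; apply/mem_upair; have [+ _] := H z; apply.
  by move=> /mem_upair ze; have [_] := H z; apply.
suff: p ⊩ IsUPair (upair u v) u v by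
  move/(upair_iff H (forces_refl _ _) (forces_refl _ _) (cohen_le_refl _)).
by move=> z; split=> q qp H1; apply/mem_upair.
Qed.

Lemma upairC p u v : p ⊩ upair u v ≡ upair v u.
Proof.
apply: forces_ext => q z _ /mem_upair H; apply/mem_upair;
  by apply: forces_or_elim H _ _ => r _ ?; [apply: forces_orr|apply: forces_orl].
Qed.

Definition opair (x y : cname) : cname := upair (upair x x) (upair x y).

Lemma pairP p e x y : (p ⊩ IsPair e x y) <-> (p ⊩ e ≡ opair x y).
Proof.
have up2 q z : (q ⊩ (IsUPair z x x ∨ IsUPair z x y)) <-> (q ⊩ z ∈ opair x y).
  rewrite mem_upair; split=> H; apply: dense_sub H _ => r _ [?|?].
  - by left; apply/upairP.
  - by right; apply/upairP.
  - by left; apply/upairP.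
  - by right; apply/upairP.
split=> [H|H].
  apply: forces_ext => q z qp ze; have [H1 H2] := H z; first by apply/up2/H1.
  by apply/H2 => //; apply/up2.
suff: p ⊩ IsPair (opair x y) x y by
  move/(pair_iff H (forces_refl _ _) (forces_refl _ _) (cohen_le_refl _)).
by move=> z; split=> q qp H1; apply/up2.
Qed.

Lemma opair_ext p x x' y y' : (p ⊩ x ≡ x') -> (p ⊩ y ≡ y') -> p ⊩ opair x y ≡ opair x' y'.
Proof.
move=> xx yy; apply/pairP; apply/(pair_iff (forces_refl _ _) xx yy (cohen_le_refl _)).
by apply/pairP; apply: forces_refl.
Qed.

Lemma opair_inj p x x' y y' : (p ⊩ opair x y ≡ opair x' y') ->
  (p ⊩ x ≡ x') /\ (p ⊩ y ≡ y').
Proof.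
have inl q a b : q ⊩ a ∈ upair a b.
  by apply/mem_upair; apply: forces_orl; apply: forces_refl.
have inr q a b : q ⊩ b ∈ upair a b.
  by apply/mem_upair; apply: forces_orr; apply: forces_refl.
have fst q u v u' v' : (q ⊩ opair u v ≡ opair u' v') -> q ⊩ u ≡ u'.
  move=> E; have /mem_upair H := forces_memr (forces_sym E) (inl _ _ _).
  have sg r : (r ⊩ u ∈ upair u' u') -> r ⊩ u ≡ u'.
    by move=> /mem_upair H'; apply: forces_or_elim H' _ _.
  by apply: forces_or_elim H _ _ => r rq /forces_sym H; apply: sg; apply: forces_memr H _.
have snd q u v u' v' : (q ⊩ opair u v ≡ opair u' v') -> q ⊩ (v ≡ u' ∨ v ≡ v').
  move=> E; have /mem_upair H := forces_memr E (inr _ _ _).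
  apply: forces_or_elim H _ _ => r rq H; have /mem_upair := forces_memr H (inr _ u v) => //.
  by move=> H'; apply: forces_or_elim H' _ _ => t tr ?; apply: forces_orl.
move=> E; have xx := fst _ _ _ _ _ E; split=> //.
apply: forces_or_elim (snd _ _ _ _ _ E) _ _ => // q qp yx.
(* If [y] equals [x'], the reversed equality makes [y'] equal to [x] or to [y]; since [x] equals
   [x'], both cases give the claim. *)
apply: forces_or_elim (snd _ _ _ _ _ (forces_sym (forces_mono qp E))) _ _ => r rq.
  move=> y'x; apply: forces_trans (forces_mono rq yx) _.
  apply: forces_trans (forces_sym y'x).
  by apply: forces_sym; apply: forces_mono xx; apply: cohen_le_trans qp.
exact: forces_sym.
Qed.

(* The canonical name of the order type of the elements below [w]. *)
Definition check (W : wellOrder) : W -> cname :=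
  Fix (@wlt_wf W) (fun=> cname)
    (fun w rec => mkset (fun v : seg w => rec (sval v) (proj2_sig v))).

Lemma checkE (W : wellOrder) (w : W) : check w = mkset (fun v : seg w => check (sval v)).
Proof.
rewrite /check Fix_eq // => x f g fg; congr mkset.
by apply: funext => v; apply: fg.
Qed.

Lemma mem_check (W : wellOrder) (w : W) a p :
  (p ⊩ a ∈ check w) <-> dense p (fun q => exists v : W, v ≺ w /\ (q ⊩ a ≡ check v)).
Proof.
rewrite checkE mem_mkset; split=> H; apply: dense_sub H _ => q _.
  by move=> [[v vw] av]; exists v.
by move=> [v [vw av]]; exists (exist _ v vw).
Qed.

Lemma mem_check_in (W : wellOrder) (v w : W) p : v ≺ w -> p ⊩ check v ∈ check w.
Proof.
by move=> vw; apply/mem_check/dense_all => q _; exists v; split; last exact: forces_refl.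
Qed.

Lemma check_irr (W : wellOrder) (w : W) p : ~ (p ⊩ check w ∈ check w).
Proof.
elim/(well_founded_ind (@wlt_wf W)): w p => w IH p /mem_check/dense_ex[q [_ [v [vw wv]]]].
by apply: (IH v vw q); apply: (forces_memr wv); apply: mem_check_in.
Qed.

Lemma check_discrete (W : wellOrder) : discrete (@check W).
Proof.
move=> p u v uv; have [lt|//|lt] := wlt_total u v; case: (@check_irr _ u p).
  by apply: (forces_memr (forces_sym uv)); apply: mem_check_in.
by apply: (forces_meml (forces_sym uv)); apply: mem_check_in.
Qed.

Lemma check_mem (W : wellOrder) (v w : W) p : (p ⊩ check v ∈ check w) -> v ≺ w.
Proof. by move=> /mem_check/dense_ex[q [_ [u [uw /check_discrete ->]]]]. Qed.

Lemma seg_discrete (W : wellOrder) (w : W) : discrete (fun v : seg w => check (sval v)).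
Proof.
move=> p [u uw] [v vw] /= /check_discrete uv; subst v; congr exist; exact: Prop_irrelevance.
Qed.

Definition whole (W : wellOrder) : cname := mkset (@check W).

Lemma forces_transitive_check (W : wellOrder) (w : W) p : p ⊩ Transitive (check w).
Proof.
rewrite checkE; apply: forces_ball_mkset => [q a b ab|[v vw]].
  by rewrite /Subset; forces_iff_tac.
move=> z q qp zv; rewrite -checkE; apply: mem_stable; move/mem_check: zv => zv.
apply: dense_sub zv _ => r rq [u [uv zu]].
by apply: (forces_meml (forces_sym zu)); apply: mem_check_in; apply: wlt_trans uv vw.
Qed.

Lemma forces_ord_whole (W : wellOrder) p : p ⊩ IsOrd (whole W).
Proof.
split; apply: forces_ball_mkset => [q a b ab|w].
- by rewrite /Subset; forces_iff_tac.
- move=> z q qp /mem_check zw; apply: mem_stable.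
  apply: dense_sub zw _ => r rq [v [vw zv]].
  by apply: (forces_meml (forces_sym zv)); apply: mem_mkset_in.
- by rewrite /Transitive /Subset; forces_iff_tac.
- exact: forces_transitive_check.
Qed.

(** * Natural numbers in the extension *)

Lemma nat_wlt_wf : well_founded (fun m n : nat => m < n).
Proof. by move=> n; elim/ltn_ind: n => n IH; constructor. Qed.

Lemma nat_wlt_trans (y x z : nat) : x < y -> y < z -> x < z.
Proof. exact: ltn_trans. Qed.

Lemma nat_wlt_total (x y : nat) : [\/ x < y, x = y | y < x].
Proof. by case: (ltngtP x y) => ?; [apply: Or31|apply: Or33|apply: Or32]. Qed.

Definition nat_order : wellOrder := WellOrder nat_wlt_wf nat_wlt_trans nat_wlt_total.

Definition num (n : nat) : cname := check (W := nat_order) n.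
Definition omega : cname := whole nat_order.

Lemma num_inj p m n : (p ⊩ num m ≡ num n) -> m = n.
Proof. exact: check_discrete. Qed.

Lemma mem_num_in p m n : m < n -> p ⊩ num m ∈ num n.
Proof. exact: (@mem_check_in nat_order). Qed.

Lemma num_mem p m n : (p ⊩ num m ∈ num n) -> m < n.
Proof. exact: (@check_mem nat_order). Qed.

Lemma emptyP p z : (p ⊩ IsEmpty z) <-> (p ⊩ z ≡ num 0).
Proof.
have e0 q a : ~ (q ⊩ a ∈ num 0).
  by move=> /mem_check/dense_ex[r [_ [v []]]].
split=> [H|H].
  apply: forces_ext => q a qp; first by move=> az; case: (H a q qp az).
  by move=> /e0.
by move=> a q qp az; apply: (e0 q a); apply: forces_memr az; apply: forces_mono H.
Qed.

Lemma succP p x y n : (p ⊩ x ≡ num n) -> (p ⊩ IsSucc x y) <-> (p ⊩ y ≡ num n.+1).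
Proof.
move=> xn.
have S q z : q ≼ p -> (q ⊩ (z ∈ x ∨ z ≡ x)) <-> (q ⊩ z ∈ num n.+1).
  move=> qp; split=> H.
    apply: forces_or_elim H _ _ => r rq H;
      have {}xn := forces_mono (cohen_le_trans rq qp) xn.
      move/(forces_memr xn)/mem_check: H => H; apply/mem_check.
      by apply: dense_sub H _ => t _ [v [vn zv]]; exists v; split=> //; apply: ltnW.
    apply/mem_check/dense_all => t tr; exists n; split; first exact: ltnSn.
    by apply: (forces_mono tr); apply: forces_trans H xn.
  move/mem_check: H => H; apply: forces_stable; apply: dense_sub H _ => r rq [v [vn zv]].
  have {}xn := forces_sym (forces_mono (cohen_le_trans rq qp) xn).
  have : v <= n := vn; rewrite leq_eqVlt => /predU1P[{}vn|{}vn].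
    by apply: forces_orr; apply: forces_trans zv _; rewrite vn.
  apply: forces_orl; apply: (forces_memr xn); apply: (forces_meml (forces_sym zv)).
  exact: mem_num_in.
split=> H.
  apply: forces_ext => q z qp zy; have [H1 H2] := H z; first by apply/(S q z qp)/H1.
  by apply: H2 => //; apply/(S q z qp).
move=> z; split=> q qp.
  by move=> zy; apply/(S q z qp); apply: forces_memr zy; apply: forces_mono H.
move=> /(S q z qp) zn; apply: forces_memr zn; apply: forces_sym; exact: forces_mono H.
Qed.

Lemma forces_inductive_omega p : p ⊩ Inductive_set omega.
Proof.
split.
  apply: (forces_bex_intro (x := num 0)); first exact: mem_mkset_in.
  by apply/emptyP; apply: forces_refl.
apply: forces_ball_mkset => [q a b ab|n]; first by rewrite /IsSucc; forces_iff_tac.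
apply: (forces_bex_intro (x := num n.+1)); first exact: (@mem_mkset_in nat_order).
by apply/succP; apply: forces_refl.
Qed.

Lemma omega_sub_inductive p x : (p ⊩ Inductive_set x) -> forall n, p ⊩ num n ∈ x.
Proof.
move=> /forces_and[H0 HS]; elim=> [|n IH].
  apply: forces_ex_elim H0 _ => q z qp [zx /emptyP z0].
  exact: forces_meml z0 zx.
have H : p ⊩ (∃ z ∈ x, IsSucc (num n) z) := HS _ p (cohen_le_refl p) IH;
  apply: forces_ex_elim H _ => q z qp [zx].
by move=> /(succP _ (forces_refl _ _)) zn; apply: forces_meml zn zx.
Qed.

Lemma forces_omega p : p ⊩ IsOmega omega.
Proof.
split; first exact: forces_inductive_omega.
move=> x q qp ix; change (q ⊩ Subset omega x); apply: forces_ball_mkset => [r a b ab|n];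
  first by forces_iff_tac.
exact: omega_sub_inductive.
Qed.

Lemma omega_unique p w : (p ⊩ IsOmega w) -> p ⊩ w ≡ omega.
Proof.
move=> /forces_and[iw mw]; apply: forces_ext => q z qp zw.
  have := mw omega p (cohen_le_refl p) (forces_inductive_omega p).
  by move=> H; apply: H zw.
move/mem_mkset: zw => zw; apply: forces_stable; apply: dense_sub zw _ => r rq [n zn].
apply: (forces_meml (forces_sym zn)); apply: omega_sub_inductive.
by apply: forces_mono iw; apply: cohen_le_trans qp.
Qed.

Lemma mem_omega p n : (p ⊩ n ∈ omega) <-> dense p (fun q => exists k, q ⊩ n ≡ num k).
Proof. exact: mem_mkset. Qed.

Lemma forces_nat_num p k : p ⊩ IsNat (num k).
Proof.
apply: (forces_ex (x := omega)); split; first exact: forces_omega.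
exact: (@mem_mkset_in nat_order).
Qed.

Lemma nat_decided p n : (p ⊩ IsNat n) -> exists q k, q ≼ p /\ (q ⊩ n ≡ num k).
Proof.
move=> /forces_exD[q [qp [w /forces_and[/omega_unique wo nw]]]].
have /mem_omega/dense_ex[r [rq [k nk]]] := forces_memr wo nw.
by exists r, k; split=> //; apply: cohen_le_trans qp.
Qed.

(** * Names for functions *)

Lemma appP p f x y : (p ⊩ App f x y) <-> (p ⊩ opair x y ∈ f).
Proof.
split=> H.
  by apply: forces_ex_elim H _ => q z qp /forces_and[zf /pairP zxy];
    apply: forces_meml zxy zf.
by apply: (forces_bex_intro H); apply/pairP; apply: forces_refl.
Qed.

Lemma app_ext p f x x' y y' : (p ⊩ x ≡ x') -> (p ⊩ y ≡ y') -> (p ⊩ App f x y) ->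
  p ⊩ App f x' y'.
Proof. by move=> xx yy; move/(app_iff (forces_refl _ _) xx yy (cohen_le_refl _)). Qed.

Section FunctionElim.
Variables (p : cohen) (f A B : cname).
Hypothesis funf : p ⊩ IsFun f A B.

Lemma fun_range x y : (p ⊩ App f x y) -> (p ⊩ x ∈ A) /\ (p ⊩ y ∈ B).
Proof.
move=> /appP xyf; have [H _] := (forces_and _ _ _).1 funf.
have {}H := forces_ball H xyf.
have H' : p ⊩ x ∈ A ∧ y ∈ B.
  apply: forces_ex_elim H _ => q a qp /forces_and[aA].
  move=> H; apply: forces_ex_elim H _ => r b rq /forces_and[bB /pairP/opair_inj[xa yb]].
  by split; [apply: (forces_meml (forces_sym xa)); apply: forces_mono aA
            |apply: (forces_meml (forces_sym yb))].
by split; case: H'.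
Qed.

Lemma fun_total x : (p ⊩ x ∈ A) -> exists q y, q ≼ p /\ (q ⊩ App f x y).
Proof.
move=> xA; have [_ /forces_and[H _]] := (forces_and _ _ _).1 funf.
by have /dense_ex[q [qp [y xy]]] := forces_ball H xA; exists q, y.
Qed.

Lemma fun_unique x y y' : (p ⊩ App f x y) -> (p ⊩ App f x y') -> p ⊩ y ≡ y'.
Proof.
have [_ /forces_and[_ H]] := (forces_and _ _ _).1 funf.
by move=> H1 H2; apply: (H x y y' p _ H1 p).
Qed.

End FunctionElim.

Lemma fun_value T (z : T -> cname) p f A x :
  (p ⊩ IsFun f A (mkset z)) -> (p ⊩ x ∈ A) -> exists q t, q ≼ p /\ (q ⊩ App f x (z t)).
Proof.
move=> funf xA; have [q [y [qp xy]]] := fun_total funf xA.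
have [_ /mem_mkset/dense_ex[r [rq [t yt]]]] := fun_range (forces_mono qp funf) xy.
exists r, t; split; first exact: cohen_le_trans qp.
by apply: app_ext (forces_refl _ _) yt _; apply: forces_mono xy.
Qed.

Lemma isfun_iff p f f' A A' B B' : (p ⊩ f ≡ f') -> (p ⊩ A ≡ A') -> (p ⊩ B ≡ B') ->
  forces_iff p (IsFun f A B) (IsFun f' A' B').
Proof.
by move=> ff AA BB; rewrite /IsFun /App /IsPair /IsUPair; forces_iff_tac.
Qed.

Lemma isfun_ext p f A A' B B' : (p ⊩ A ≡ A') -> (p ⊩ B ≡ B') ->
  (p ⊩ IsFun f A B) -> p ⊩ IsFun f A' B'.
Proof. by move=> AA BB; move/(isfun_iff (forces_refl _ _) AA BB (cohen_le_refl _)). Qed.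

Definition graph_name (T : Type) (x y : T -> cname) : cname :=
  mkset (fun t => opair (x t) (y t)).

Section FunctionNames.
Variables (T S : Type) (x : T -> cname) (z : S -> cname) (F : T -> S).
Let f := graph_name x (z \o F).

Lemma app_graph p a b : (p ⊩ App f a b) <->
  dense p (fun q => exists t, (q ⊩ a ≡ x t) /\ (q ⊩ b ≡ z (F t))).
Proof.
rewrite appP mem_mkset; split=> H; apply: dense_sub H _ => q _ [t].
  by move/opair_inj; exists t.
by move=> [at' bt]; exists t; apply: opair_ext.
Qed.

Lemma app_graph_in p t : p ⊩ App f (x t) (z (F t)).
Proof. by apply/app_graph/dense_all => q qp; exists t; split; apply: forces_refl. Qed.

Lemma fun_graph p : discrete x -> p ⊩ IsFun f (mkset x) (mkset z).
Proof.
move=> dx; split; [|split].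
- apply: forces_ball_mkset => [q a b ab|t]; first by rewrite /IsPair /IsUPair;
    forces_iff_tac.
  apply: (forces_bex_intro (mem_mkset_in x t p)).
  apply: (forces_bex_intro (mem_mkset_in z (F t) p)).
  by apply/pairP; apply: forces_refl.
- apply: forces_ball_mkset => [q a b ab|t].
    by rewrite /App /IsPair /IsUPair; forces_iff_tac.
  by apply: (forces_ex (x := z (F t))); apply: app_graph_in.
- move=> a b b' q qp /app_graph H r rq /app_graph H'.
  apply: (@forces_stable (b ≡ b')); apply: dense_dense.
  apply: dense_sub (dense_mono rq H) _ => t tr [u [au bu]].
  apply: dense_sub (dense_mono tr H') _ => v vt [u' [au' bu']].
  have eu : u = u'.
    by apply: (dx v); apply: forces_trans au'; apply: forces_sym; apply: forces_mono au.
  by rewrite -eu in bu'; apply: forces_trans (forces_sym bu'); apply: forces_mono bu.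
Qed.

Lemma inj_graph p : discrete z -> injective F -> p ⊩ InjectiveOn f (mkset x).
Proof.
move=> dz inj a q qp _ b r rq _ c t tr /app_graph H u ut /app_graph H'.
apply: (@forces_stable (a ≡ b)); apply: dense_dense.
apply: dense_sub (dense_mono ut H) _ => v vu [i [ai ci]].
apply: dense_sub (dense_mono vu H') _ => w wv [j [bj cj]].
have eij : i = j.
  by apply/inj/(dz w); apply: forces_trans cj; apply: forces_sym; apply: forces_mono ci.
by rewrite -eij in bj; apply: forces_trans (forces_sym bj); apply: forces_mono ai.
Qed.

Lemma surj_graph p : (forall s, exists t, F t = s) -> p ⊩ Surjective f (mkset x) (mkset z).
Proof.
move=> surj; apply: forces_ball_mkset => [q a b ab|s].
  by rewrite /App /IsPair /IsUPair; forces_iff_tac.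
have [t <-] := surj s.
by apply: (forces_bex_intro (mem_mkset_in x t p)); apply: app_graph_in.
Qed.

End FunctionNames.

Lemma forces_countable T (x : T -> cname) (F : T -> nat) p :
  discrete x -> injective F -> p ⊩ Defs.Countable (mkset x).
Proof.
move=> dx inj; apply: (forces_ex (x := omega)); split; first exact: forces_omega.
apply: (forces_ex (x := graph_name x (num \o F))); split.
  exact: (@fun_graph T nat x num F).
by apply: inj_graph inj => q m n; apply: num_inj.
Qed.

Lemma forces_finite T (x : T -> cname) k (F : T -> seg (k : nat_order)) p :
  discrete x -> injective F -> (forall s, exists t, F t = s) -> p ⊩ Defs.Finite (mkset x).
Proof.
move=> dx inj surj; apply: (forces_ex (x := num k)); split; first exact: forces_nat_num.
rewrite /num checkE; apply: (forces_ex (x :=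
  graph_name x ((fun v : seg (k : nat_order) => check (sval v)) \o F))).
split; first exact: fun_graph.
split; last exact: surj_graph.
by apply: inj_graph => //; apply: seg_discrete.
Qed.

(* A Cohen condition decides the value of [f] at each [check w], and there are
   only countably many pairs of a condition and a value. *)
Lemma no_injection (W : omega1) T (z : T -> cname) (F : T -> nat) p f :
    injective F -> (p ⊩ IsFun f (whole W) (mkset z)) -> ~ (p ⊩ InjectiveOn f (whole W)).
Proof.
move=> inj funf injf.
have /choice[c cP] : forall w : W, exists qt : cohen * T,
    qt.1 ≼ p /\ (qt.1 ⊩ App f (check w) (z qt.2)).
  by move=> w; have [q [t ?]] := fun_value funf (mem_mkset_in (@check W) w p);
    exists (q, t).
have [v [w [nvw [eq1 eq2]]]] := omega1_pigeonhole (fun w : W => ((c w).1, F (c w).2)).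
have {}eq2 := inj _ _ eq2; have [vp fv] := cP v; have [_ fw] := cP w.
rewrite -eq1 -eq2 in fw.
apply: nvw; apply: (@check_discrete W (c v).1).
by apply: (injf _ _ vp (mem_mkset_in _ _ _) _ _ (cohen_le_refl _) (mem_mkset_in _ _ _) _
  _ _ fv _ _ fw).
Qed.

(** Cohen forcing preserves [omega1]: [no_injection] excludes an injection into [omega] below any
    condition. *)
Lemma whole_uncountable (W : omega1) p : p ⊩ ¬ Defs.Countable (whole W).
Proof.
apply: forces_notI => q qp /forces_exD[r [rq [w /forces_and[/omega_unique wo
  /forces_exD[t [tr [f /forces_and[funf injf]]]]]]]].
have {}funf := isfun_ext (forces_refl _ _) (forces_mono tr wo) funf.
exact: (@no_injection W nat num id t f) funf injf.
Qed.

Lemma seg_enum (W : omega1) (w : W) : injective (fun v : seg w => enum_below w (sval v)).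
Proof.
move=> [u uw] [v vw] /= /(enum_belowI uw vw) uv; subst v; congr exist;
  exact: Prop_irrelevance.
Qed.

Lemma check_countable (W : omega1) (w : W) p : p ⊩ Defs.Countable (check w).
Proof. by rewrite checkE; apply: forces_countable (@seg_enum W w); apply: seg_discrete. Qed.

Lemma countable_iff p a b : (p ⊩ a ≡ b) ->
  forces_iff p (Defs.Countable a) (Defs.Countable b).
Proof.
move=> ab; rewrite /Defs.Countable /IsFun /InjectiveOn /App /IsPair /IsUPair;
  forces_iff_tac.
Qed.

Lemma forces_omega1 (W : omega1) p : p ⊩ IsOmega1 (whole W).
Proof.
split; first exact: forces_ord_whole.
split; first exact: whole_uncountable.
apply: forces_ball_mkset => [q a b|w]; first exact: countable_iff.
exact: check_countable.
Qed.

Lemma forces_card_whole (W : omega1) p : p ⊩ IsCard (whole W).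
Proof.
split; first exact: forces_ord_whole.
apply: forces_ball_mkset => [q a b ab|w].
  rewrite /Equinumerous /IsFun /InjectiveOn /Surjective /App /IsPair /IsUPair;
    forces_iff_tac.
apply: forces_notI => q qp /forces_exD[r [rq [f /forces_and[funf /forces_and[injf _]]]]].
by rewrite checkE in funf; apply: no_injection (@seg_enum W w) funf injf.
Qed.

(** * Arithmetic and the graph in the extension *)

Lemma numeralP p k t : (p ⊩ IsNumeral k t) -> p ⊩ t ≡ num k.
Proof.
elim: k p t => [|k IH] p t; first by move/emptyP.
move=> H; apply: forces_ex_elim H _ => q m qp /forces_and[/IH mk /(succP _ mk)].
exact.
Qed.

Lemma at_most_leq p a b i j : (p ⊩ a ≡ num i) -> (p ⊩ b ≡ num j) ->
  (p ⊩ AtMost a b) -> i <= j.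
Proof.
move=> ai bj /dense_ex[q [qp [|]]] ab.
  apply: ltnW; apply: (@num_mem q); apply: (forces_memr (forces_mono qp bj)).
  exact: forces_meml (forces_mono qp ai) ab.
suff -> : i = j by [].
apply: (@num_inj q); apply: forces_trans (forces_mono qp bj).
by apply: forces_trans ab; apply: forces_sym; apply: forces_mono ai.
Qed.

(** Whatever name witnesses the recursion, induction on [i] pins its value at [num i] to the double
    of [i], as long as [i <= j]. *)
Lemma double_elim p k d j : (p ⊩ k ≡ num j) -> (p ⊩ IsDouble k d) -> p ⊩ d ≡ num j.*2.
Proof.
move=> kj H; apply: forces_ex_elim H _ => q w qp /forces_and[_ H].
apply: forces_ex_elim H _ => r k1 rq /forces_and[_ H].
apply: forces_ex_elim H _ => t f tr /forces_and[funf /forces_and[f0 /forces_and[fS fd]]].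
have {}kj : t ⊩ k ≡ num j.
  by apply: forces_mono kj; apply: cohen_le_trans tr (cohen_le_trans rq qp).
have fi i : i <= j -> t ⊩ App f (num i) (num i.*2).
  elim: i => [_|i IH ij].
    apply: forces_ex_elim f0 _ => v z vt /forces_and[/emptyP z0]; exact: app_ext.
  have {IH}fi := IH (ltnW ij).
  have H := forces_ball fS (forces_memr (forces_sym kj) (mem_num_in _ ij)).
  apply: forces_ex_elim H _ => v i1 vt /forces_and[/(succP _ (forces_refl _ _)) i1E H].
  apply: forces_ex_elim H _ => v1 u v1v H.
  apply: forces_ex_elim H _ => v2 u1 v2v1 H.
  apply: forces_ex_elim H _ => v3 u2 v3v2.
  move=> /forces_and[fu /forces_and[u1E /forces_and[u2E fu2]]].
  have v3v : v3 ≼ v by apply: cohen_le_trans v3v2 (cohen_le_trans v2v1 v1v).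
  have v3t := cohen_le_trans v3v vt.
  have uE := fun_unique (forces_mono v3t funf) fu (forces_mono v3t fi).
  have {}u1E := (succP _ uE).1 u1E; have {}u2E := (succP _ u1E).1 u2E.
  by rewrite doubleS; apply: app_ext (forces_mono v3v i1E) u2E fu2.
apply: (fun_unique funf fd); apply: app_ext (forces_sym kj) (forces_refl _ _) _.
exact: fi.
Qed.

Lemma forces_double p k : p ⊩ IsDouble (num k) (num k.*2).
Proof.
apply: (forces_ex (x := omega)); split; first exact: forces_omega.
apply: (forces_ex (x := num k.+1)); split; first by apply/succP; apply: forces_refl.
pose F (v : seg (k.+1 : nat_order)) := (sval v : nat).*2.
pose x (v : seg (k.+1 : nat_order)) := check (sval v).
have fi q i : i <= k -> q ⊩ App (graph_name x (num \o F)) (num i) (num i.*2).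
  move=> ik; exact: (@app_graph_in _ _ x num F q (exist _ (i : nat_order) (ik : i < k.+1))).
apply: (forces_ex (x := graph_name x (num \o F))); split.
  by rewrite /num (checkE (k.+1 : nat_order)); apply: fun_graph; apply: seg_discrete.
split.
  apply: (forces_ex (x := num 0)); split; first by apply/emptyP; apply: forces_refl.
  exact: (fi _ 0).
split; last exact: fi.
rewrite /num (checkE (k : nat_order)); apply: forces_ball_mkset => [q a b ab|[i ik]].
  rewrite /IsSucc /App /IsPair /IsUPair; forces_iff_tac.
apply: (forces_ex (x := num i.+1)); split; first by apply/succP; apply: forces_refl.
apply: (forces_ex (x := num i.*2)); apply: (forces_ex (x := num i.*2.+1)).
apply: (forces_ex (x := num i.*2.+2)).
split; first by apply: fi; apply: ltnW.
split; first by apply/succP; apply: forces_refl.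
split; first by apply/succP; apply: forces_refl.
by rewrite -doubleS; apply: fi.
Qed.

Lemma double_succ_elim p k m j : (p ⊩ k ≡ num j) -> (p ⊩ IsDoubleSucc k m) ->
  p ⊩ m ≡ num j.*2.+1.
Proof.
move=> kj H; apply: forces_ex_elim H _ => q d qp /forces_and[].
by move=> /(double_elim (forces_mono qp kj)) dj /(succP _ dj).
Qed.

Lemma forces_double_succ p k : p ⊩ IsDoubleSucc (num k) (num k.*2.+1).
Proof.
apply: (forces_ex (x := num k.*2)); split; first exact: forces_double.
by apply/succP; apply: forces_refl.
Qed.

(** Used to let a single condition settle all vertices and edges of a cycle, by extending once for
    each index. *)
Lemma decide_finite (D : nat -> cohen -> Prop) p k :
    (forall i q r, r ≼ q -> D i q -> D i r) ->
    (forall i q, i < k -> q ≼ p -> exists r, r ≼ q /\ D i r) ->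
  exists q, q ≼ p /\ forall i, i < k -> D i q.
Proof.
move=> mono; elim: k => [|k IH] ext; first by exists p; split.
have [|q [qp qD]] := IH; first by move=> i q ik; apply: ext; apply: ltnW.
have [r [rq rD]] := ext k q (ltnSn k) qp.
exists r; split=> [|i]; first exact: cohen_le_trans qp.
by rewrite ltnS leq_eqVlt => /predU1P[->//|/qD]; apply: mono.
Qed.

(** * The Hajnal-Máté graph in the extension *)

Section Graph.
Variables (W : omega1) (w : nat) (s : W -> nat -> W).
Let X := whole W.

(** Each edge is attached to every condition that already grants it, so the generic graph consists
    of the edges granted by finite parts of the Cohen real. *)
Definition hm_name : cname :=
  @Name cohen {t : W * W * cohen | hm_edge w s t.2 t.1.1 t.1.2}
    (fun t => upair (check (sval t).1.1) (check (sval t).1.2)) (fun t => (sval t).2).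
Let E := hm_name.

Lemma mem_hm_name p e : (p ⊩ e ∈ E) <->
  dense p (fun q => exists g b : W,
    hm_edge w s q g b /\ (q ⊩ e ≡ upair (check g) (check b))).
Proof.
split=> H; apply: dense_sub H _ => q _.
  move=> [[[[g b] r] gb] [qr eE]]; exists g, b; split=> //.
  exact: hm_edge_mono qr gb.
move=> [g [b [gb eE]]].
exists (exist (fun t : W * W * cohen => hm_edge w s t.2 t.1.1 t.1.2) (g, b, q) gb).
by split=> //; apply: cohen_le_refl.
Qed.

Lemma hm_edge_in p (g b : W) : hm_edge w s p g b -> p ⊩ upair (check g) (check b) ∈ E.
Proof.
move=> gb; apply/mem_hm_name/dense_all => q qp; exists g, b.
by split; [apply: hm_edge_mono gb|apply: forces_refl].
Qed.

Lemma upair_check p (u v u' v' : W) :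
    (p ⊩ upair (check u) (check v) ≡ upair (check u') (check v')) ->
  (u = u' \/ u = v') /\ (v = u' \/ v = v').
Proof.
have or_check q (a b c : W) : (q ⊩ (check a ≡ check b ∨ check a ≡ check c)) ->
  a = b \/ a = c.
  by move=> /dense_ex[r [_ [/check_discrete|/check_discrete]]]; [left|right].
move=> H; split; apply: (or_check p); apply/mem_upair; apply: (forces_memr H);
  apply/mem_upair.
  by apply: forces_orl; apply: forces_refl.
by apply: forces_orr; apply: forces_refl.
Qed.

Lemma edge_adj p (g b : W) : (p ⊩ Edge E (check g) (check b)) ->
  exists q, q ≼ p /\ hm_adj w s q g b.
Proof.
move=> /forces_exD[q [qp [e /forces_and[/mem_hm_name/dense_ex[r [rq [g' [b' [gb' eE]]]]]
  /upairP eE']]]].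
exists r; split; first exact: cohen_le_trans qp.
have eq1 := forces_trans (forces_sym (forces_mono rq eE')) eE.
have irr x : ~ hm_edge w s r x x by case=> /wlt_irr.
have [g'E b'E] := upair_check (forces_sym eq1).
have [[gE|gE] [bE|bE]] := upair_check eq1; rewrite gE bE in g'E b'E *.
- by case: (irr g'); move: gb'; case: b'E => ->.
- by left.
- by right.
- by case: (irr b'); move: gb'; case: g'E => ->.
Qed.

Lemma adj_edge p (g b : W) : hm_adj w s p g b -> p ⊩ Edge E (check g) (check b).
Proof.
case=> gb; apply: (forces_bex_intro (hm_edge_in gb)).
  by apply/upairP; apply: forces_refl.
by apply/upairP; apply: upairC.
Qed.

Lemma edge_iff p u u' v v' : (p ⊩ u ≡ u') -> (p ⊩ v ≡ v') ->
  forces_iff p (Edge E u v) (Edge E u' v').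
Proof. by move=> uu vv; rewrite /Edge /IsUPair; forces_iff_tac. Qed.

Lemma edge_ext p u u' v v' : (p ⊩ u ≡ u') -> (p ⊩ v ≡ v') ->
  (p ⊩ Edge E u v) -> p ⊩ Edge E u' v'.
Proof. by move=> uu vv; move/(edge_iff uu vv (cohen_le_refl _)). Qed.

Lemma forces_graph p : p ⊩ IsGraph X E.
Proof.
move=> e q qp /mem_hm_name He.
change (q ⊩ (∃ u ∈ X, ∃ v ∈ X, (¬ u ≡ v) ∧ IsUPair e u v)).
apply: forces_stable; apply: dense_sub He _ => r rq [g [b [gb eE]]].
apply: (forces_bex_intro (mem_mkset_in (@check W) g r)).
apply: (forces_bex_intro (mem_mkset_in (@check W) b r)).
split; last by apply/upairP.
by move=> t tr /check_discrete egb; case: gb => + _ _ _ _; rewrite egb => /wlt_irr.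
Qed.

(** The colours below [nu] are countably many through [enum_below nu]. For each vertex a condition
    deciding its colour is chosen; [hm_chromatic] then finds two vertices with the same condition
    and colour, and an extension joining them. *)
Lemma not_colorable p (nu : W) : 0 < w ->
    rich (w * w * 2 + w + 1).+1 0 s (fun=> True) ->
  p ⊩ ¬ Colorable X E (check nu).
Proof.
move=> w0 rich_s; apply: forces_notI =>
  q qp /forces_exD[r [rq [c /forces_and[func proper]]]].
rewrite checkE in func.
have /choice[d dP] : forall x : W, exists qt : cohen * seg nu,
    qt.1 ≼ r /\ (qt.1 ⊩ App c (check x) (check (sval qt.2))).
  by move=> x; have [t [v ?]] := fun_value func (mem_mkset_in (@check W) x r);
    exists (t, v).
have [g [b [t [egb tg gb]]]] :=
  hm_chromatic (fun x => ((d x).1, enum_below nu (sval (d x).2))) w0 rich_s.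
case: egb => eq1 /(@seg_enum W nu) eq2 /=.
have [gr cg] := dP g; have [_ cb] := dP b; rewrite -eq1 -eq2 in cb.
have tr := cohen_le_trans tg gr.
have H1 := forces_ball (forces_mono tr proper) (mem_mkset_in (@check W) g t).
have H2 := forces_ball H1 (mem_mkset_in (@check W) b t).
apply: (H2 (check (sval (d g).2)) t _ _ t _ _ t) => //.
- by apply: adj_edge; left.
- exact: forces_mono cg.
- exact: forces_mono cb.
Qed.

Lemma forces_colorable p : p ⊩ Colorable X E X.
Proof.
apply: (forces_ex (x := graph_name (@check W) (@check W \o id))); split.
  by apply: fun_graph; apply: check_discrete.
apply: forces_ball_mkset => [q a b ab|u].
  by rewrite /Edge /App /IsPair /IsUPair; forces_iff_tac.
apply: forces_ball_mkset => [q a b ab|v].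
  by rewrite /Edge /App /IsPair /IsUPair; forces_iff_tac.
move=> k q qp /edge_adj[q' [q'q adj]] r rq /app_graph cu t tr /app_graph cv.
have /dense_ex[t1 [t1t [u' [/check_discrete uu' ku']]]] := dense_mono tr cu.
have /dense_ex[t2 [t2t1 [v' [/check_discrete vv' kv']]]] := dense_mono t1t cv.
have uv : u' = v'.
  by apply: (@check_discrete W t2); apply: forces_trans kv'; apply: forces_sym;
    apply: forces_mono ku'.
by move: adj; rewrite uu' vv' uv; case=> -[/wlt_irr].
Qed.

Lemma forces_hajnal_mate p : 0 < w -> rich (w * w * 2 + w + 1).+1 0 s (fun=> True) ->
  p ⊩ HajnalMate X E.
Proof.
move=> w0 rich_s; split; first exact: forces_graph.
split.
  apply: (forces_ex (x := X)); split; last exact: whole_uncountable.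
  split; first exact: forces_card_whole.
  split; first exact: forces_colorable.
  apply: forces_ball_mkset => [q a b ab|nu].
    rewrite /IsCard /IsOrd /Transitive /Subset /Equinumerous /Colorable /IsFun.
    by rewrite /InjectiveOn /Surjective /App /IsPair /IsUPair; forces_iff_tac.
  by move=> q qp _; apply: not_colorable.
apply: forces_ball_mkset => [q a b ab|b].
  by rewrite /Edge /IsUPair; forces_iff_tac.
rewrite {1}checkE; apply: forces_ball_mkset => [q a a' aa|[a ab]].
  by forces_iff_tac.
(* Padding with any values makes the condition longer than the number of [a] in [b]; by
   [hm_edge_decided] it then fixes all neighbours of [b] below [a]. *)
move=> q qp; pose r := q ++ nseq (enum_below b a).+1 0.
exists r; split; first exact: cohen_le_cat.
have ar : enum_below b a < size r by rewrite size_cat size_nseq; lia.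
have [k [h [hI hP]]] := hm_edge_finite w s r a b.
exists (mkset (fun i : seg (k : nat_order) => check (h (sval i)))); split; last first.
  apply: (@forces_finite _ _ k id) => // [t [i ik] [j jk] /check_discrete /= hij|i];
    last by exists i.
  by have e := hI _ _ ik jk hij; subst j; congr exist; apply: Prop_irrelevance.
move=> g; split=> t tr.
  move=> /mem_mkset gN; change (t ⊩ g ∈ check a ∧ Edge E g (check b)).
  apply: forces_stable; apply: dense_sub gN _ => u ut [[i ik] /= gh].
  have [ha hb] := (hP (h i)).2 (ex_intro2 _ _ i ik erefl).
  split; first by apply: (forces_meml (forces_sym gh)); apply: mem_check_in.
  apply: edge_ext (forces_sym gh) (forces_refl _ _) _; apply: adj_edge; left.
  by apply: hm_edge_mono hb; apply: cohen_le_trans tr.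
move=> [/mem_check ga gb]; have {}gb : t ⊩ Edge E g (check b) := gb;
  apply/mem_mkset => u ut.
have /dense_ex[v [vu [c [ca gc]]]] := dense_mono ut ga.
have /edge_adj[v' [v'v adj]] := edge_ext gc (forces_refl _ _) (forces_mono
  (cohen_le_trans vu ut) gb).
exists v'; split; first exact: cohen_le_trans vu.
have v'r : v' ≼ r by apply: cohen_le_trans v'v (cohen_le_trans vu (cohen_le_trans ut tr)).
have cb := hm_edge_decided v'r ab ar ca (hm_adj_lt (wlt_trans ca ab) adj).
have [i ik hi] := (hP c).1 (conj ca cb).
by exists (exist _ (i : nat_order) ik); rewrite /= hi; apply: forces_mono gc.
Qed.

(** The forced cycle becomes an actual sequence of vertices, to which the combinatorial lemmas
    apply. The last clause identifies the names for values of [c] that other formulas introduce on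
    their own. *)
Lemma cycle_decided p n c : (p ⊩ IsCycle X E n c) ->
  exists q k (x : nat -> W),
    [/\ q ≼ p, q ⊩ n ≡ num k, 3 <= k /\ x k = x 0,
        forall i j, i < k -> j < k -> x i = x j -> i = j &
        (forall i, i < k -> hm_adj w s q (x i) (x i.+1)) /\
        forall i y, i <= k -> forall r, r ≼ q -> (r ⊩ App c (num i) y) ->
          r ⊩ y ≡ check (x i)].
Proof.
move=> /forces_and[/nat_decided[q1 [k [q1p nk]]]].
move=> /(forces_mono q1p)/forces_and[three].
move=> /forces_and[/forces_exD[q2 [q21 [n1 /forces_and[n1E func]]]]].
move=> /(forces_mono q21)/forces_and[close /forces_and[injc edges]].
have {}nk := forces_mono q21 nk; have {}three := forces_mono q21 three.
have {n1E} n1E := (succP _ nk).1 n1E.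
have {n1E} func := isfun_ext n1E (forces_refl _ _) func.
have k3 : 3 <= k.
  have /forces_exD[r [rq [t /forces_and[/numeralP t3 tn]]]] := three.
  exact: at_most_leq t3 (forces_mono rq nk) tn.
(* There are [k.+1] values to decide, since [c] is also defined at its length, where it returns to
   its start. *)
have [|i q ik qq2|q3 [q32 cx]] := @decide_finite
    (fun i q => exists x : W, q ⊩ App c (num i) (check x)) q2 k.+1.
- by move=> i q r rq [x cx]; exists x; apply: forces_mono cx.
- have [r [x [rq cx]]] := fun_value (forces_mono qq2 func) (mem_num_in q ik).
  by exists r; split=> //; exists x.
have /choice[x xP] : forall i, exists x : W, i < k.+1 -> q3 ⊩ App c (num i) (check x).
  move=> i; have [/cx[x]|] := boolP (i < k.+1); first by exists x.
  by have [x _] := omega1_uncountable (fun _ : W => 0); exists x.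
have uniq r i y : r ≼ q3 -> i <= k -> (r ⊩ App c (num i) y) -> r ⊩ y ≡ check (x i).
  move=> rq3 ik ciy; apply: (fun_unique (forces_mono (cohen_le_trans rq3 q32) func) ciy).
  exact: forces_mono (xP i ik).
have [|i q ik qq3|q4 [q43 adj]] := @decide_finite
    (fun i q => hm_adj w s q (x i) (x i.+1)) q3 k.
- by move=> i q r; apply: hm_adj_mono.
- have qq2 := cohen_le_trans qq3 q32.
  have ni := forces_memr (forces_sym (forces_mono qq2 nk)) (mem_num_in q ik).
  have /forces_exD[r1 [r1q [i1 /forces_and[/(succP _ (forces_refl _ _)) i1E]]]] :=
    forces_ball (forces_mono qq2 edges) ni.
  move=> /forces_exD[r2 [r21 [u /forces_exD[r3 [r32 [v /forces_and[cu /forces_and[cv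
    uv]]]]]]]].
  have r3r1 := cohen_le_trans r32 r21; have r3q := cohen_le_trans r3r1 r1q.
  have r3q3 := cohen_le_trans r3q qq3.
  have uE := uniq _ _ _ r3q3 (ltnW ik) cu.
  have vE := uniq _ _ _ r3q3 ik (app_ext (forces_mono r3r1 i1E) (forces_refl _ _) cv).
  have [r [rr3 ?]] := edge_adj (edge_ext uE vE uv).
  by exists r; split=> //; apply: cohen_le_trans r3q.
have q42 := cohen_le_trans q43 q32.
exists q4, k, x; split.
- exact: cohen_le_trans q42 (cohen_le_trans q21 q1p).
- exact: forces_mono nk.
- split=> //.
  have /forces_exD[r1 [r1q [z /forces_and[/emptyP z0]]]] := forces_mono q42 close.
  move=> /forces_exD[r2 [r21 [u /forces_and[cz cn]]]].
  have r2q4 := cohen_le_trans r21 r1q; have r2q3 := cohen_le_trans r2q4 q43.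
  have u0 := uniq _ _ _ r2q3 (leq0n k) (app_ext (forces_mono r21 z0) (forces_refl _ _) cz).
  have nk2 := forces_mono (cohen_le_trans r2q3 q32) nk.
  have uk := uniq _ _ _ r2q3 (leqnn k) (app_ext nk2 (forces_refl _ _) cn).
  by apply: (@check_discrete W r2); apply: forces_trans u0; apply: forces_sym.
- move=> i j ik jk xij; apply: (@num_inj q3).
  have nk3 := forces_sym (forces_mono q32 nk).
  have H1 := forces_ball (forces_mono q32 injc) (forces_memr nk3 (mem_num_in q3 ik)).
  have H2 := forces_ball H1 (forces_memr nk3 (mem_num_in q3 jk)).
  apply: (H2 (check (x i)) q3 (cohen_le_refl _) (xP i (ltnW ik)) q3 (cohen_le_refl _)).
  by rewrite xij; apply: xP; apply: ltnW.
- split=> // i y ik r rq4; apply: uniq => //; exact: cohen_le_trans q43.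
Qed.

Lemma forces_special_free p : p ⊩ SpecialCycleFree X E.
Proof.
apply: forces_notI => q qp /forces_exD[q1 [q1q [n /forces_exD[q2 [q21 [c /forces_and[cyc
  spec]]]]]]].
have [q3 [k [x [q32 nk [k3 xk] xI [adj val]]]]] := cycle_decided cyc.
have /forces_exD[q4 [q43 [r /forces_and[rn mono]]]] := forces_mono q32 spec.
have nk4 := forces_mono q43 nk.
have /mem_check/dense_ex[q5 [q54 [t [tk rt]]]] := forces_memr nk4 rn.
have {tk}tk : t < k := tk; have {rt}rt : q5 ⊩ r ≡ num t := rt.
have {}nk := forces_mono q54 nk4; have q53 := cohen_le_trans q54 q43.
have step i : i < k -> exists q6, q6 ≼ q5 /\
    (q6 ⊩ (num i ∈ r → check (x i.+1) ∈ check (x i)) ∧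
          ((¬ num i ∈ r) → check (x i) ∈ check (x i.+1))).
  move=> ik; have ni := forces_memr (forces_sym nk) (mem_num_in q5 ik).
  have /forces_exD[r1 [r1q [i1 /forces_and[/(succP _ (forces_refl _ _)) i1E]]]] :=
    forces_ball (forces_mono q54 mono) ni.
  move=> /forces_exD[r2 [r21 [u /forces_exD[r3 [r32 [v]]]]]].
  move=> /forces_and[cu /forces_and[cv dir]].
  have r3r1 := cohen_le_trans r32 r21; have r3q5 := cohen_le_trans r3r1 r1q.
  have r3q3 := cohen_le_trans r3q5 q53.
  have uE := val _ _ (ltnW ik) _ r3q3 cu.
  have vE := val _ _ ik _ r3q3 (app_ext (forces_mono r3r1 i1E) (forces_refl _ _) cv).
  exists r3; split=> //; move: dir.
  have iff : forces_iff r3 ((num i ∈ r → v ∈ u) ∧ ((¬ num i ∈ r) → u ∈ v))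
      ((num i ∈ r → check (x i.+1) ∈ check (x i)) ∧
          ((¬ num i ∈ r) → check (x i) ∈ check (x i.+1))) by forces_iff_tac.
  by move/(iff _ (cohen_le_refl _)).
apply: (@hm_special_free W w s q3 k t x) => //.
- move=> i it; have [q6 [q65 /forces_and[+ _]]] := step i (ltn_trans it tk).
  move/forces_mp => H; apply: (@check_mem W _ _ q6); apply: H.
  exact: forces_memr (forces_sym (forces_mono q65 rt)) (mem_num_in q6 it).
- move=> i ti ik; have [q6 [q65 /forces_and[_]]] := step i ik.
  move/forces_mp => H; apply: (@check_mem W _ _ q6); apply: H.
  apply: forces_notI => q7 q76 /(forces_memr (forces_mono (cohen_le_trans q76 q65) rt)).
  by move/num_mem; rewrite ltnNge ti.
Qed.

Lemma forces_odd_free p m : w = m.*2.+1 -> p ⊩ NoOddCyclesUpTo X E (num m.*2.+1).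
Proof.
move=> wm; apply: forces_notI => q qp /forces_exD[q1 [q1q [n /forces_exD[q2 [q21 [c]]]]]].
move=> /forces_and[cyc /forces_and[oddn nm]].
have [q3 [k [x [q32 nk [k3 xk] xI [adj val]]]]] := cycle_decided cyc.
have kw := at_most_leq nk (forces_refl _ _) (forces_mono q32 nm).
have /forces_exD[q4 [q43 [j /forces_and[/nat_decided[q5 [i [q54 ji]]] dn]]]] :=
  forces_mono q32 oddn.
have ni := double_succ_elim ji (forces_mono q54 dn).
have ki : k = i.*2.+1.
  apply: (@num_inj q5); apply: forces_trans ni; apply: forces_sym.
  by apply: forces_mono nk; apply: cohen_le_trans q43.
apply: (@hm_odd_free W w s q3 k x) => //; first by rewrite wm.
by rewrite ki /= odd_double.
Qed.

End Graph.

Theorem theorem3p5 : forall p : cohen,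
  forces cohen_le p
    (∃ w, ∃ w1, IsOmega w ∧ IsOmega1 w1 ∧
     ∀ s ∈ w, ∃ E, HajnalMate w1 E ∧ SpecialCycleFree w1 E ∧
       ∃ m, IsDoubleSucc s m ∧ NoOddCyclesUpTo w1 E m)%F.
Proof.
move=> p; have [W] := omega1_exists.
apply: (forces_ex (x := omega)); apply: (forces_ex (x := whole W)).
split; first exact: forces_omega.
split; first exact: forces_omega1.
apply: forces_ball_mkset => [q a b ab|m].
  rewrite /IsDoubleSucc /IsDouble /IsSucc; forces_iff_tac.
(* The shift is [w = m.*2.+1], the longest odd length to exclude. Tuples have length
   [w * w * 2 + w + 1], and one more coordinate holds the floor. *)
have [s rich_s] :=
  rich_exists ((m.*2.+1 * m.*2.+1 * 2 + m.*2.+1 + 1).+1) 0 (@stationaryT W).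
apply: (forces_ex (x := @hm_name W m.*2.+1 s)).
split; first exact: forces_hajnal_mate.
split; first exact: forces_special_free.
apply: (forces_ex (x := num m.*2.+1)); split; first exact: forces_double_succ.
exact: forces_odd_free.
Qed.
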